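(* Let $n\ge 1$, let $t_1<\dots<t_n$ be real numbers, $t_0=-\infty$, $t_{n+1}=+\infty$, let $p_0,\dots,p_n>0$, and let $p=\sum_{j=0}^n p_j\chi_{I_j}$ where $I_0=(-\infty,t_1]$, $I_j=(t_j,t_{j+1}]$ for $1\le j\le n-1$, $I_n=(t_n,\infty)$. Put $q_k=p_k^{-1/2}$. Then there exist analytic functions $a_l^+,b_l^+$ ($0\le l\le n-1$) and $a_j^-,b_j^-$ ($1\le j\le n$) from $\mathbb{C}\setminus(-\infty,0]$ to $\mathbb{C}$ such that for every $z\in\mathbb{C}\setminus(-\infty,0]$ the functions $$\Phi^+(z,x)=\begin{cases}a_l^+(z)e^{iq_l\sqrt z x}+b_l^+(z)e^{-iq_l\sqrt z x}, & x\in I_l,\ 0\le l\le n-1,\\ e^{iq_n\sqrt z x}, & x\in I_n,\end{cases}$$ $$\Phi^-(z,x)=\begin{cases}e^{-iq_0\sqrt z x}, & x\in I_0,\\ a_j^-(z)e^{iq_j\sqrt z x}+b_j^-(z)e^{-iq_j\sqrt z x}, & x\in I_j,\ 1\le j\le n,\end{cases}$$ are solutions of $(\tau_p-z)f=0$ that depend analytically on $z\in\mathbb{C}\setminus(-\infty,0]$. If $\operatorname{Im}z>0$, then $(\Phi^+(z,\cdot),\Phi^-(z,\cdot))$ is a fundamental system of $(\tau_p-z)f=0$ such that $\Phi^+(z,\cdot)$ lies right and $\Phi^-(z,\cdot)$ lies left in $L^2(\mathbb{R})$. If $\operatorname{Im}z<0$, then $(\overline{\Phi^+(\bar z,\cdot)},\overline{\Phi^-(\bar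 z,\cdot)})$ is a fundamental system of $(\tau_p-z)f=0$ such that $\overline{\Phi^+(\bar z,\cdot)}$ lies right and $\overline{\Phi^-(\bar z,\cdot)}$ lies left in $L^2(\mathbb{R})$. Moreover, with $a_n^+=1$, $b_n^+=0$, $a_0^-=0$, $b_0^-=1$ and $$L_k(z)=\frac12\begin{bmatrix}\left(1+\frac{q_k}{q_{k-1}}\right)e^{it_k(q_{k-1}-q_k)\sqrt z} & \left(1-\frac{q_k}{q_{k-1}}\right)e^{-it_k(q_{k-1}+q_k)\sqrt z}\\ \left(1-\frac{q_k}{q_{k-1}}\right)e^{it_k(q_{k-1}+q_k)\sqrt z} & \left(1+\frac{q_k}{q_{k-1}}\right)e^{-it_k(q_{k-1}-q_k)\sqrt z}\end{bmatrix},\quad 1\le k\le n,$$ the coefficients satisfy the recursion relations $\begin{bmatrix}a_k^\pm(z)\\ b_k^\pm(z)\end{bmatrix}=L_k(z)\begin{bmatrix}a_{k-1}^\pm(z)\\ b_{k-1}^\pm(z)\end{bmatrix}$ (for all $k$ for which both sides are defined), and consequently the coefficients $a^\pm_k,b^\pm_k$ are almost periodic trigonometric polynomials in the variable $\sqrt z$, i.e. finite sums $\sum_m c_m e^{i\lambda_m\sqrt z}$ with $c_m\in\mathbb{C}$, $\lambda_m\in\mathbb{R}$.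
   Context: $\sqrt z$ denotes the principal square root: for $z=re^{i\theta}$ with $r>0$, $-\pi<\theta<\pi$, $\sqrt z=\sqrt r e^{i\theta/2}$. A solution of $(\tau_p-z)f=0$ is a function $f:\mathbb{R}\to\mathbb{C}$ such that $f$ and $pf'$ are locally absolutely continuous on $\mathbb{R}$ and $-(pf')'=zf$ almost everywhere. A function $f$ lies right (resp. left) in $L^2(\mathbb{R})$ if $f\in L^2(c,\infty)$ (resp. $f\in L^2(-\infty,c)$) for some $c\in\mathbb{R}$. *)

(* Defs.v *)
From HB Require Import structures.
From mathcomp Require Import all_boot all_order all_algebra.
From mathcomp Require Import complex.
From mathcomp Require Import all_classical all_reals all_analysis.
Import Order.TTheory GRing.Theory Num.Theory.
Import numFieldNormedType.Exports.

Set Implicit Arguments.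
Unset Strict Implicit.
Unset Printing Implicit Defensive.

Local Open Scope classical_set_scope.
Local Open Scope ring_scope.

Section Defs.
Variable R : realType.
Local Notation C := R[i].

Definition RtoC (x : R) : C := (x +i* 0)%C.

Definition cmod (w : C) : R :=
  Num.sqrt (complex.Re w ^+ 2 + complex.Im w ^+ 2).

Definition cexp (w : C) : C :=
  (expR (complex.Re w) * cos (complex.Im w)
     +i* (expR (complex.Re w) * sin (complex.Im w)))%C.

(* principal square root: for z = r e^{i theta}, -pi < theta <= pi,
   psqrt z = sqrt r e^{i theta/2}  (written in cartesian form) *)
Definition psqrt (z : C) : C :=
  (Num.sqrt ((cmod z + complex.Re z) / 2)
     +i* ((if complex.Im z < 0 then -1 else 1) *
          Num.sqrt ((cmod z - complex.Re z) / 2)))%C.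

Definition slit : set C :=
  [set z | ~ (complex.Im z = 0 /\ complex.Re z <= 0)].

(* analytic (= complex differentiable at every point) on an open set D *)
Definition holo_on (D : set C) (f : C -> C) : Prop :=
  forall z, D z -> derivable (f : C^o -> C^o) z 1.

Definition has_deriv_at (f : R -> C) (x : R) (l : C) : Prop :=
  ((fun h : R => (f (x + h) - f x) / RtoC h) : R -> C^o) @ 0^' --> (l : C^o).

(* absolute continuity on [a, b] (finite families of non-overlapping
   subintervals [u k, v k], listed in increasing order) *)
Definition abs_cont_on (f : R -> C) (a b : R) : Prop :=
  forall e : R, 0 < e -> exists2 d : R, 0 < d &
    forall (m : nat) (u v : nat -> R),
      (forall k, (k < m)%N -> a <= u k /\ u k <= v k /\ v k <= b) ->
      (forall k, (k.+1 < m)%N -> v k <= u k.+1) ->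
      \sum_(k < m) (v k - u k) < d ->
      \sum_(k < m) cmod (f (v k) - f (u k)) < e.

Definition loc_abs_cont (f : R -> C) : Prop :=
  forall a b : R, a <= b -> abs_cont_on f a b.

(* f is a solution of (tau_p - z) f = 0, i.e. -(p f')' = z f a.e., where
   f and p f' are locally absolutely continuous; g is the locally
   absolutely continuous function equal to p f' almost everywhere. *)
Definition is_solution (p : R -> R) (z : C) (f : R -> C) : Prop :=
  loc_abs_cont f /\
  exists g : R -> C,
    [/\ loc_abs_cont g,
        {ae (@lebesgue_measure R), forall x,
           exists l, has_deriv_at f x l /\ g x = RtoC (p x) * l} &
        {ae (@lebesgue_measure R), forall x, has_deriv_at g x (- (z * f x))}].

Definition fundamental_system (p : R -> R) (z : C) (f1 f2 : R -> C) : Prop :=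
  [/\ is_solution p z f1, is_solution p z f2 &
      forall al be : C, (forall x, al * f1 x + be * f2 x = 0) ->
        al = 0 /\ be = 0].

Definition L2_on (A : set R) (f : R -> C) : Prop :=
  [/\ measurable_fun A (fun x => complex.Re (f x)),
      measurable_fun A (fun x => complex.Im (f x)) &
      (\int[@lebesgue_measure R]_(x in A) ((cmod (f x)) ^+ 2)%:E < +oo)%E].

Definition lies_right_L2 (f : R -> C) : Prop :=
  exists c : R, L2_on [set x | c <= x] f.
Definition lies_left_L2 (f : R -> C) : Prop :=
  exists c : R, L2_on [set x | x <= c] f.

Definition Ij (n : nat) (t : nat -> R) (j : nat) : set R :=
  if j == 0%N then [set x | x <= t 1%N]
  else if j == n then [set x | t n < x]
  else [set x | t j < x /\ x <= t j.+1].

Definition pfun (n : nat) (t : nat -> R) (pc : nat -> R) (x : R) : R :=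
  \sum_(0 <= j < n.+1) pc j * \1_(Ij n t j) x.

Definition qcoef (pc : nat -> R) (k : nat) : R := (Num.sqrt (pc k))^-1.

Definition Phi (n : nat) (t : nat -> R) (q : nat -> R)
    (a b : nat -> C -> C) (z : C) (x : R) : C :=
  \sum_(0 <= j < n.+1) RtoC (\1_(Ij n t j) x) *
     (a j z * cexp ('i%C * RtoC (q j) * psqrt z * RtoC x)
      + b j z * cexp (- ('i%C * RtoC (q j) * psqrt z * RtoC x))).

Definition Lmat (t : nat -> R) (q : nat -> R) (k : nat) (z : C) : 'M[C]_2 :=
  let r := RtoC (q k / q k.-1) in
  let e := fun s : R => cexp ('i%C * RtoC (t k * s) * psqrt z) in
  2^-1 *: \matrix_(i < 2, j < 2)
    (if i == 0 then
       if j == 0 then (1 + r) * e (q k.-1 - q k)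
       else (1 - r) * e (- (q k.-1 + q k))
     else
       if j == 0 then (1 - r) * e (q k.-1 + q k)
       else (1 + r) * e (- (q k.-1 - q k))).

Definition colv (a b : C) : 'cV[C]_2 :=
  \col_(i < 2) (if i == 0 then a else b).

Definition trig_poly_sqrt (f : C -> C) : Prop :=
  exists s : seq (C * R), forall z, slit z ->
    f z = \sum_(cl <- s) cl.1 * cexp ('i%C * RtoC cl.2 * psqrt z).

End Defs.
Arguments slit {R}.

(* Main.v *)
Require Import Defs.
From HB Require Import structures.
From mathcomp Require Import all_boot all_order all_algebra.
From mathcomp Require Import complex.
From mathcomp Require Import all_classical all_reals all_analysis.
From mathcomp Require Import measurable_realfun ring lra.
Import Order.TTheory GRing.Theory Num.Theory.
Import numFieldNormedType.Exports.
Local Open Scope classical_set_scope.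
Local Open Scope ring_scope.

Set Implicit Arguments.
Unset Strict Implicit.
Unset Printing Implicit Defensive.

(** On each interval the solutions are spanned by the exponentials
    [e^{+- i q_k sqrt z x}], and continuity of [f] and of [p f'] at [t_k] is the
    linear transfer by [L_k], which is inverted by exchanging [q_{k-1}] and [q_k].
    Hence [Phi^-] is obtained by transferring forward from [I_0] and [Phi^+]
    backward from [I_n]. For [Im z > 0] the energy [Im (p f' conj f)] has
    derivative [- Im z |f|^2]; along [Phi^-] it is negative on [I_0], while it
    would be nonnegative on [I_n] if the coefficient [b_n^-] vanished. So
    [b_n^- <> 0] and [Phi^+], [Phi^-] are independent on [I_n]. The lower half
    plane follows by conjugation. *)

(** The only exponentials that occur are [e^{i lambda sqrt z}] with [lambda] real. Each entry of
    [L_k] is a constant multiple of one of them, so the coefficients, and [Phi] at fixed [x], remain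
    finite sums of such exponentials. Analyticity therefore rests on [cexp] and [psqrt] alone; as
    both are given in cartesian form, it is obtained from explicit remainder bounds. The
    quasi-derivative is normalised by [i sqrt z], so that the matching conditions at [t_k] involve
    [z] only through exponentials. Up to the factor [-2 i sqrt z / q_n], the number [b_n^-] is the
    Wronskian of [Phi^+] and [Phi^-]. If it vanished for [Im z > 0], then [Phi^-] would be square
    integrable at both ends, an eigenfunction of a symmetric operator with a non-real eigenvalue.
    The energy argument excludes this by comparing signs at [t_1] and [t_n] only, with no integral
    over the line; the signs come from [Re (sqrt z) > 0]. *)

Section ComplexModulus.
Variable R : realType.
Local Notation C := R[i].
Local Notation Re := (@complex.Re R).
Local Notation Im := (@complex.Im R).
Implicit Types (x y : R) (w z : C).

Lemma ReD w z : Re (w + z) = Re w + Re z. Proof. by case: w z => ? ? []. Qed.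
Lemma ImD w z : Im (w + z) = Im w + Im z. Proof. by case: w z => ? ? []. Qed.
Lemma ReN w : Re (- w) = - Re w. Proof. by case: w. Qed.
Lemma ImN w : Im (- w) = - Im w. Proof. by case: w. Qed.
Lemma ReM w z : Re (w * z) = Re w * Re z - Im w * Im z.
Proof. by case: w z => ? ? []. Qed.
Lemma ImM w z : Im (w * z) = Re w * Im z + Im w * Re z.
Proof. by case: w z => ? ? []. Qed.
Lemma ReRtoC x : Re (RtoC x) = x. Proof. by []. Qed.
Lemma ImRtoC x : Im (RtoC x) = 0. Proof. by []. Qed.
Lemma Re_conj w : Re w^* = Re w. Proof. by case: w. Qed.
Lemma Im_conj w : Im w^* = - Im w. Proof. by case: w. Qed.

Lemma Re1 : Re 1 = 1. Proof. by []. Qed.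
Lemma Im1 : Im 1 = 0. Proof. by []. Qed.
Lemma Re_i : Re 'i%C = 0. Proof. by []. Qed.
Lemma Im_i : Im 'i%C = 1. Proof. by []. Qed.
Lemma Re_cexp w : Re (cexp w) = expR (Re w) * cos (Im w). Proof. by []. Qed.
Lemma Im_cexp w : Im (cexp w) = expR (Re w) * sin (Im w). Proof. by []. Qed.

Definition ReImE := (Re_i, Im_i, Re1, Im1, ReD, ImD, ReN, ImN, ReM, ImM, Re_conj,
  Im_conj, Re_cexp, Im_cexp, ReRtoC, ImRtoC).

Lemma complex_ext w z : Re w = Re z -> Im w = Im z -> w = z.
Proof. by case: w z => ? ? [? ?] /= -> ->. Qed.

Lemma RtoC0 : RtoC (0 : R) = 0. Proof. by []. Qed.
Lemma RtoCD x y : RtoC (x + y) = RtoC x + RtoC y.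
Proof. by apply: complex_ext; rewrite !ReImE ?addr0. Qed.
Lemma RtoCN x : RtoC (- x) = - RtoC x.
Proof. by apply: complex_ext; rewrite !ReImE ?oppr0. Qed.
Lemma RtoCM x y : RtoC (x * y) = RtoC x * RtoC y.
Proof. by apply: complex_ext; rewrite !ReImE; ring. Qed.
Lemma RtoC_eq0 x : (RtoC x == 0) = (x == 0).
Proof. by rewrite eq_complex /= eqxx andbT. Qed.
Lemma RtoCV x : RtoC x^-1 = (RtoC x)^-1.
Proof.
have [->|x0] := eqVneq x 0; first by rewrite invr0 RtoC0 invr0.
apply: (mulfI (_ : RtoC x != 0)); first by rewrite RtoC_eq0.
by rewrite -RtoCM divff ?divff ?RtoC_eq0.
Qed.
Lemma RtoC_conj x : (RtoC x)^* = RtoC x.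
Proof. by apply: complex_ext; rewrite !ReImE ?oppr0. Qed.

Lemma RtoC_le x y : (RtoC x <= RtoC y) = (x <= y). Proof. exact: lecR. Qed.
Lemma RtoC_inj : injective (@RtoC R). Proof. exact: complexI. Qed.

Lemma normc_cmod w : `|w| = RtoC (cmod w). Proof. exact: normc_def. Qed.

Lemma cmod_ge0 w : 0 <= cmod w. Proof. exact: sqrtr_ge0. Qed.

Lemma cmodD w z : cmod (w + z) <= cmod w + cmod z.
Proof. by rewrite -RtoC_le RtoCD -!normc_cmod ler_normD. Qed.

Lemma cmodM w z : cmod (w * z) = cmod w * cmod z.
Proof. by apply: RtoC_inj; rewrite RtoCM -!normc_cmod normrM. Qed.

Lemma cmodN w : cmod (- w) = cmod w.
Proof. by apply: RtoC_inj; rewrite -!normc_cmod normrN. Qed.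

Lemma cmodV w : cmod w^-1 = (cmod w)^-1.
Proof. by apply: RtoC_inj; rewrite RtoCV -!normc_cmod normfV. Qed.

Lemma cmodJ w : cmod w^* = cmod w.
Proof. by rewrite /cmod !ReImE sqrrN. Qed.

Lemma sqr_cmod w : cmod w ^+ 2 = Re w ^+ 2 + Im w ^+ 2.
Proof. by rewrite sqr_sqrtr // addr_ge0 ?sqr_ge0. Qed.

Lemma cmod_RtoC x : cmod (RtoC x) = `|x|.
Proof. by rewrite /cmod !ReImE expr0n addr0 sqrtr_sqr. Qed.

Lemma Re_le_cmod w : `|Re w| <= cmod w.
Proof. by rewrite -sqrtr_sqr ler_sqrt ?lerDl ?sqr_ge0 // addr_ge0 ?sqr_ge0. Qed.

Lemma Im_le_cmod w : `|Im w| <= cmod w.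
Proof. by rewrite -sqrtr_sqr ler_sqrt ?lerDr ?sqr_ge0 // addr_ge0 ?sqr_ge0. Qed.

Lemma cmod_le w : cmod w <= `|Re w| + `|Im w|.
Proof.
rewrite -(@ler_pXn2r _ 2) ?nnegrE ?addr_ge0 ?normr_ge0 ?cmod_ge0 //.
rewrite sqr_cmod sqrrD !real_normK ?num_real // lerD2r lerDl.
by rewrite mulrn_wge0 // mulr_ge0.
Qed.

(** The norm of [C] has values in [C], so the radius in the definition of the limit is a positive
    element of [C]; positivity forces its imaginary part to vanish, which leaves a real [e]. *)
Lemma cvg_cmodP {T} (F : set_system T) (FF : Filter F) (f : T -> C) (l : C) :
  (f : T -> C^o) @ F --> (l : C^o) <->
  (forall e : R, 0 < e -> \forall x \near F, cmod (l - f x) <= e).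
Proof.
split=> [/cvgrPdist_le fl e e0|fl].
  have e0' : 0 < RtoC e by rewrite ltcE /= eqxx.
  by apply: filterS (fl _ e0') => x; rewrite /= normc_cmod RtoC_le.
apply/cvgrPdist_le => /= -[e e'] /[!ltcE]/= /andP[/eqP -> e0].
by apply: filterS (fl _ e0) => x; rewrite normc_cmod (RtoC_le _ e).
Qed.

End ComplexModulus.

(** * Analyticity of the exponential and of the principal square root *)

Section ComplexExponential.
Variable R : realType.
Local Notation C := R[i].
Implicit Types (x y : R) (w z : C).

Lemma cexp0 : cexp (0 : C) = 1.
Proof. by apply: complex_ext => /=; rewrite expR0 ?cos0 ?sin0 mul1r. Qed.

Lemma cexpD w z : cexp (w + z) = cexp w * cexp z.
Proof.
by apply: complex_ext; rewrite (ReM, ImM) /= ReD ImD expRD (cosD, sinD); ring.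
Qed.

Lemma cexpN_mul w : cexp (- w) * cexp w = 1.
Proof. by rewrite -cexpD addNr cexp0. Qed.

Lemma cexpN w : cexp (- w) = (cexp w)^-1.
Proof.
have := cexpN_mul w; have [->|e0] := eqVneq (cexp w) 0.
  by rewrite mulr0 => /esym/eqP; rewrite oner_eq0.
by move=> H; apply: (mulIf e0); rewrite H mulVf.
Qed.

Lemma cexp_neq0 w : cexp w != 0.
Proof.
by apply/eqP => e0; have /eqP := cexpN_mul w; rewrite e0 mulr0 eq_sym oner_eq0.
Qed.

Lemma cmod_cexp w : cmod (cexp w) = expR (complex.Re w).
Proof.
rewrite /cmod /= !exprMn -mulrDr cos2Dsin2 mulr1 sqrtr_sqr.
by rewrite ger0_norm ?expR_ge0.
Qed.

End ComplexExponential.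

Section ComplexDerivative.
Variable R : realType.
Local Notation C := R[i].
Implicit Types (x y : R) (w z : C).

(** Clearing the denominator makes the bound hold at [h = 0] too, so no punctured neighbourhood is
    carried through the estimates. *)
Lemma is_derive_remainder {u : R -> R} {x a : R} : is_derive x 1 u a ->
  forall e : R, 0 < e -> exists2 d : R, 0 < d &
    forall h, `|h| < d -> `|u (x + h) - u x - a * h| <= e * `|h|.
Proof.
move=> [du <-] e e0.
have /cvgrPdist_le/(_ e e0) := du.
move=> /nbhs_ballP[d /= d0 H]; exists d => // h hd.
have [->|h0] := eqVneq h 0; first by rewrite addr0 subrr !mulr0 subr0 normr0 mulr0.
have /= := H h; rewrite /ball /= sub0r normrN => /(_ hd h0).
rewrite -(ler_pM2r (_ : 0 < `|h|)) ?normr_gt0 // -normrM mulrBl.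
rewrite -[_^-1 *: _]/(_^-1 * _) mulrAC mulVf // mul1r distrC.
by rewrite -[h *: 1]/(h * 1) mulr1 [h + x]addrC.
Qed.

Lemma remainder_derivable (f : C -> C) z l :
  (forall e : R, 0 < e -> exists2 d : R, 0 < d &
    forall h, cmod h < d -> cmod (f (z + h) - f z - l * h) <= e * cmod h) ->
  derivable (f : C^o -> C^o) z 1.
Proof.
move=> H; apply/cvg_ex; exists (l : C^o).
apply/cvg_cmodP => e e0; have [d d0 Hd] := H e e0.
have d0' : 0 < RtoC d by rewrite ltcE /= eqxx.
near=> h.
have h0 : h != 0 by near: h; exact: nbhs_dnbhs_neq.
have hd : cmod h < d.
  have : `|h| < RtoC d by near: h; exact: dnbhs0_lt.
  by rewrite normc_cmod ltcE /= eqxx.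
have ch0 : 0 < cmod h by rewrite lt_def cmod_ge0 andbT; apply: contra h0 => /eqP/eqP;
  rewrite -(inj_eq (@RtoC_inj R)) -normc_cmod normr_eq0.
rewrite -(ler_pM2r ch0) -cmodM mulrBl.
rewrite -[_^-1 *: _]/(_^-1 * _) mulrAC mulVf // mul1r -opprB cmodN /=.
by rewrite -[h *: 1]/(h * 1) mulr1 [h + z]addrC; exact: Hd.
Unshelve. all: by end_near. Qed.

Lemma cderivable_comp (f g : C -> C) z :
  derivable (f : C^o -> C^o) z 1 -> derivable (g : C^o -> C^o) (f z) 1 ->
  derivable ((fun w => g (f w)) : C^o -> C^o) z 1.
Proof.
move=> /derivable1_diffP df /derivable1_diffP dg.
by apply/derivable1_diffP; exact: (differentiable_comp df dg).
Qed.

Lemma cexp_remainder (e : R) : 0 < e -> exists2 d : R, 0 < d &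
  forall h : C, cmod h < d -> cmod (cexp h - 1 - h) <= e * cmod h.
Proof.
(* The real part of the remainder costs [(3 + 1) e' |h|] and the imaginary part [(3 + 2) e' |h|],
   whence the [9]; the bound by [1] ensures [expR x <= 3]. *)
move=> e0; pose e' := Num.min 1 (e / 9).
have e'0 : 0 < e' by rewrite lt_min ltr01 divr_gt0.
have e'1 : e' <= 1 by rewrite ge_min lexx.
have e'e : 9 * e' <= e.
  by rewrite mulrC -ler_pdivlMr // ge_min lexx orbT.
clearbody e'.
have [d1 d10 H1] := is_derive_remainder (is_derive_expR (0 : R)) e'0.
have [d2 d20 H2] := is_derive_remainder (is_derive_cos (0 : R)) e'0.
have [d3 d30 H3] := is_derive_remainder (is_derive_sin (0 : R)) e'0.
exists (Num.min e' (Num.min d1 (Num.min d2 d3))); first by rewrite !lt_min e'0 d10 d20.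
move=> h; rewrite !lt_min => /and4P[he' hd1 hd2 hd3].
have := Re_le_cmod h; have := Im_le_cmod h.
set x := complex.Re h; set y := complex.Im h.
set m := cmod h in he' hd1 hd2 hd3 * => ym xm.
have {H1}:= H1 x (le_lt_trans xm hd1); have {H2}:= H2 y (le_lt_trans ym hd2).
have {H3}:= H3 y (le_lt_trans ym hd3).
rewrite !add0r expR0 cos0 sin0 oppr0 !mul1r mul0r !subr0 addr0 => H3 H2 H1.
have m0 : 0 <= m := le_trans (normr_ge0 _) xm.
have {}H1 : `|expR x - 1 - x| <= e' * m by apply: le_trans H1 _; rewrite ler_pM2l.
have {}H2 : `|cos y - 1| <= e' * m by apply: le_trans H2 _; rewrite ler_pM2l.
have {}H3 : `|sin y - y| <= e' * m by apply: le_trans H3 _; rewrite ler_pM2l.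
have e'm : e' * m <= m by rewrite ler_piMl.
have ex1 : `|expR x - 1| <= 2 * m.
  rewrite (_ : _ - 1 = (expR x - 1 - x) + x); last by ring.
  by apply: le_trans (ler_normD _ _) _; lra.
have ex : expR x <= 3.
  have : expR x - 1 <= 2 * m by exact: le_trans (ler_norm _) ex1.
  lra.
have ex0 := expR_ge0 x.
apply: le_trans (cmod_le _) _; apply: le_trans (_ : 9 * (e' * m) <= _); last first.
  by rewrite mulrA ler_wpM2r.
rewrite !ReImE -/x -/y oppr0 addr0.
rewrite (_ : _ - 1 - x = expR x * (cos y - 1) + (expR x - 1 - x)); last by ring.
rewrite (_ : _ - y = expR x * (sin y - y) + (expR x - 1) * y); last by ring.
apply: le_trans (lerD (ler_normD _ _) (ler_normD _ _)) _.
rewrite !normrM (ger0_norm ex0).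
have A1 : expR x * `|cos y - 1| <= 3 * (e' * m) by apply: ler_pM.
have A2 : expR x * `|sin y - y| <= 3 * (e' * m) by apply: ler_pM.
have A3 : `|expR x - 1| * `|y| <= 2 * e' * m.
  by apply: ler_pM => //; apply: le_trans ex1 _; lra.
lra.
Qed.

Lemma cexp_derivable w : derivable (@cexp R : C^o -> C^o) w 1.
Proof.
apply: (remainder_derivable (l := (cexp w))) => e e0.
pose k := cmod (cexp w).
have k0 : 0 < k by rewrite /k cmod_cexp expR_gt0.
have [d d0 H] := cexp_remainder (divr_gt0 e0 k0).
exists d => // h hd.
rewrite cexpD (_ : _ - _ - _ = cexp w * (cexp h - 1 - h)); last by ring.
rewrite cmodM -/k; apply: le_trans (_ : k * (e / k * cmod h) <= _).
  by rewrite ler_pM2l // H.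
by rewrite mulrA mulrCA divff ?gt_eqF // mulr1.
Qed.

Lemma sqr_psqrt z : psqrt z * psqrt z = z.
Proof.
have := Re_le_cmod z; rewrite ler_norml => /andP[H1 H2].
have A : 0 <= (cmod z + complex.Re z) / 2 by lra.
have B : 0 <= (cmod z - complex.Re z) / 2 by lra.
apply: complex_ext; rewrite (ReM, ImM) /=.
  set s := (if _ then _ else _).
  have s2 : s * s = 1 by rewrite /s; case: ifP => _; ring.
  rewrite mulrACA s2 mul1r -!expr2 !sqr_sqrtr //; lra.
(* The two radicands multiply to [(Im z / 2)^2], and the sign in [psqrt] turns [|Im z|] back into
   [Im z]. *)
rewrite mulrCA -[X in _ + X]mulrA [X in _ + _ * X]mulrC -mulrDr -mulr2n.
rewrite -sqrtrM // (_ : _ / 2 * _ = (complex.Im z / 2) ^+ 2); last first.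
  have := sqr_cmod z; set m := cmod z => E.
  rewrite exprMn; have -> : complex.Im z ^+ 2 = m ^+ 2 - complex.Re z ^+ 2.
    by rewrite E addrC addKr.
  by field.
rewrite sqrtr_sqr normrM [`|2^-1|]ger0_norm ?invr_ge0 // mulr2n.
by case: ltP => Hi; [rewrite ltr0_norm //|rewrite ger0_norm //]; field.
Qed.

Lemma Re_psqrt_ge0 z : 0 <= complex.Re (psqrt z).
Proof. exact: sqrtr_ge0. Qed.

Lemma Re_psqrt_gt0 z : slit z -> 0 < complex.Re (psqrt z).
Proof.
move=> sz; rewrite /= sqrtr_gt0 divr_gt0 //.
have [Rz|Rz] := ltP 0 (complex.Re z); first by rewrite ltr_wpDl ?cmod_ge0.
have Iz : complex.Im z != 0 by apply/eqP => Iz; apply: sz.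
rewrite -ltrBlDr sub0r -(@ltr_pXn2r _ 2) ?nnegrE ?cmod_ge0 ?oppr_ge0 //.
by rewrite sqr_cmod sqrrN ltrDl exprn_even_gt0.
Qed.

(** Let [s], [s'] be the roots at [z] and [z + h]. Then [(s' - s)(s' + s) = h], while [Re s' >= 0]
    and [Re s = r > 0] give [|s' + s| >= r]. Hence [|s' - s| <= |h| / r] without continuity being
    known beforehand, and the remainder is exactly [-(s' - s)^2 / (2 s)]. *)
Lemma psqrt_derivable z : slit z -> derivable (@psqrt R : C^o -> C^o) z 1.
Proof.
move=> /Re_psqrt_gt0; set s := psqrt z; set r := complex.Re s => r0.
have s0 : s != 0 by apply/eqP => s0; move: r0; rewrite /r s0 ltxx.
apply: (remainder_derivable (l := (2 * s)^-1)) => e e0.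
(* The remainder is at most [|h|^2 / (2 r^3)]. *)
exists (e * (2 * r ^+ 3)); first by rewrite mulr_gt0 // mulr_gt0 // exprn_gt0.
move=> h hd; set S := psqrt (z + h) + s; set D := psqrt (z + h) - s.
have DS : D * S = h by rewrite /D /S mulrDr !mulrBl !sqr_psqrt; ring.
have rs : r <= cmod s := le_trans (ler_norm _) (Re_le_cmod s).
have rS : r <= cmod S.
  apply: le_trans (le_trans (ler_norm _) (Re_le_cmod S)).
  by rewrite /S ReD lerDr Re_psqrt_ge0.
have Dr : cmod D <= cmod h / r.
  by rewrite ler_pdivlMr // -DS cmodM ler_wpM2l ?cmod_ge0.
have -> : D - (2 * s)^-1 * h = - (D * D / (2 * s)).
  rewrite -DS (_ : S = D + 2 * s); last by rewrite /S /D; ring.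
  by field; rewrite s0.
have -> : cmod (- (D * D / (2 * s))) = cmod D * cmod D / (2 * cmod s).
  rewrite cmodN !cmodM cmodV cmodM; congr (_ / (_ * _)).
  by rewrite (_ : 2 = RtoC 2) ?cmod_RtoC ?ger0_norm // RtoCD.
rewrite ler_pdivrMr; last by rewrite mulr_gt0 // (lt_le_trans r0).
apply: le_trans (ler_pM (cmod_ge0 _) (cmod_ge0 _) Dr Dr) _.
apply: le_trans (_ : e * cmod h * (2 * r) <= _); last first.
  by rewrite ler_wpM2l ?mulr_ge0 ?cmod_ge0 ?(ltW e0) // ler_pM2l.
have -> : cmod h / r * (cmod h / r) = cmod h * (cmod h / r ^+ 2).
  by field; rewrite gt_eqF.
have -> : e * cmod h * (2 * r) = cmod h * (e * (2 * r)) by ring.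
rewrite ler_wpM2l ?cmod_ge0 // ler_pdivrMr ?exprn_gt0 //.
by apply: le_trans (ltW hd) _; rewrite -!mulrA -exprS.
Qed.

End ComplexDerivative.

Section TrigonometricPolynomials.
Variable R : realType.
Local Notation C := R[i].
Implicit Types (f g : C -> C) (c z : C) (x : R).

Definition sqrt_exp x z : C := cexp ('i%C * RtoC x * psqrt z).

(* Unlike [trig_poly_sqrt], the expansion is required on the whole plane, so
   that no localisation to the slit plane is needed to differentiate it. *)
Definition sqrt_trig_poly f :=
  exists s : seq (C * R), forall z, f z = \sum_(cl <- s) cl.1 * sqrt_exp cl.2 z.

Lemma sqrt_trig_poly_slit f : sqrt_trig_poly f -> trig_poly_sqrt f.
Proof. by case=> s fE; exists s => z _. Qed.

Lemma sqrt_exp0 z : sqrt_exp 0 z = 1.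
Proof. by rewrite /sqrt_exp mulr0 mul0r cexp0. Qed.

Lemma sqrt_expD x y z : sqrt_exp (x + y) z = sqrt_exp x z * sqrt_exp y z.
Proof. by rewrite /sqrt_exp -cexpD RtoCD mulrDr mulrDl. Qed.

Lemma sqrt_expN x z : sqrt_exp (- x) z = (sqrt_exp x z)^-1.
Proof. by rewrite /sqrt_exp -cexpN RtoCN mulrN mulNr. Qed.

Lemma sqrt_exp_neq0 x z : sqrt_exp x z != 0.
Proof. exact: cexp_neq0. Qed.

Lemma sqrt_trig_poly_cst c : sqrt_trig_poly (fun=> c).
Proof. by exists [:: (c, 0)] => z; rewrite big_seq1 sqrt_exp0 mulr1. Qed.

Lemma sqrt_trig_polyD f g :
  sqrt_trig_poly f -> sqrt_trig_poly g -> sqrt_trig_poly (fun z => f z + g z).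
Proof. by move=> [s fE] [s' gE]; exists (s ++ s') => z; rewrite big_cat -fE -gE. Qed.

(** Multiplication by a monomial shifts every frequency by [x]. The entries of [L_k] and the two
    exponentials of a wave are all monomials. *)
Lemma sqrt_trig_polyZ c x f :
  sqrt_trig_poly f -> sqrt_trig_poly (fun z => c * sqrt_exp x z * f z).
Proof.
move=> [s fE]; exists [seq (c * cl.1, x + cl.2) | cl <- s] => z.
rewrite big_map fE mulr_sumr; apply: eq_bigr => cl _ /=.
by rewrite sqrt_expD; ring.
Qed.

Lemma cderivable_cst c z : derivable ((fun=> c) : C^o -> C^o) z 1.
Proof. exact: derivable_cst. Qed.

Lemma cderivableD f g z :
  derivable (f : C^o -> C^o) z 1 -> derivable (g : C^o -> C^o) z 1 ->
  derivable ((fun w => f w + g w) : C^o -> C^o) z 1.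
Proof. exact: derivableD. Qed.

Lemma cderivableM f g z :
  derivable (f : C^o -> C^o) z 1 -> derivable (g : C^o -> C^o) z 1 ->
  derivable ((fun w => f w * g w) : C^o -> C^o) z 1.
Proof. exact: derivableM. Qed.

Lemma cderivable_sum I (r : seq I) (F : I -> C -> C) z :
  (forall i, derivable (F i : C^o -> C^o) z 1) ->
  derivable ((fun w => \sum_(i <- r) F i w) : C^o -> C^o) z 1.
Proof.
move=> dF; elim: r => [|i r IH].
  rewrite (_ : (fun _ => _) = fun=> 0); first exact: cderivable_cst.
  by apply/funext => w; rewrite big_nil.
rewrite (_ : (fun _ => _) = fun w => F i w + \sum_(j <- r) F j w).
  exact (cderivableD (dF i) IH).
by apply/funext => w; rewrite big_cons.
Qed.

Lemma sqrt_exp_derivable x z : slit z ->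
  derivable (sqrt_exp x : C^o -> C^o) z 1.
Proof.
move=> sz; apply: (@cderivable_comp R _ (@cexp R)); last exact: cexp_derivable.
by apply: cderivableM (psqrt_derivable sz); exact: cderivable_cst.
Qed.

Lemma sqrt_trig_poly_holo f : sqrt_trig_poly f -> holo_on slit f.
Proof.
move=> [s fE] z sz; rewrite (_ : f = fun z => \sum_(cl <- s) cl.1 * sqrt_exp cl.2 z).
  apply: cderivable_sum => cl; apply: cderivableM; first exact: cderivable_cst.
  exact: sqrt_exp_derivable.
exact/funext.
Qed.

End TrigonometricPolynomials.

(** * Transfer of coefficients across a break *)

Section Transfer.
Variable R : realType.
Local Notation C := R[i].
Implicit Types (x q : R) (z : C) (v w : C * C).

(* The value and the quasi-derivative of [v.1 e^{iq sqrt z x} + v.2 e^{-iq sqrt z x}]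
   for the coefficient [p = q^-2], the latter divided by [i sqrt z]. *)
Definition wave_val q z v x : C :=
  v.1 * sqrt_exp (q * x) z + v.2 * (sqrt_exp (q * x) z)^-1.
Definition wave_der q z v x : C :=
  (RtoC q)^-1 * (v.1 * sqrt_exp (q * x) z - v.2 * (sqrt_exp (q * x) z)^-1).

Definition transfer x q q' z v : C * C :=
  let r := RtoC (q' / q) in
  (2^-1 * ((1 + r) * sqrt_exp (x * (q - q')) z * v.1
     + (1 - r) * sqrt_exp (x * - (q + q')) z * v.2),
   2^-1 * ((1 - r) * sqrt_exp (x * (q + q')) z * v.1
     + (1 + r) * sqrt_exp (x * - (q - q')) z * v.2)).

(** Expresses the four exponentials of [L_k] through those of the two adjacent waves at [x], so that
    the matching identities become rational identities accessible to [field]. *)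
Lemma sqrt_exp_transfer x q q' z :
  (sqrt_exp (x * - (q - q')) z = (sqrt_exp (q * x) z)^-1 * sqrt_exp (q' * x) z) *
  (sqrt_exp (x * - (q + q')) z = (sqrt_exp (q * x) z)^-1 / sqrt_exp (q' * x) z) *
  (sqrt_exp (x * (q - q')) z = sqrt_exp (q * x) z / sqrt_exp (q' * x) z) *
  (sqrt_exp (x * (q + q')) z = sqrt_exp (q * x) z * sqrt_exp (q' * x) z).
Proof.
by do !split; rewrite ?mulrN -?sqrt_expN -!sqrt_expD; congr (sqrt_exp _ z); ring.
Qed.

Lemma wave_val_transfer x q q' z v : q != 0 ->
  wave_val q' z (transfer x q q' z v) x = wave_val q z v x.
Proof.
move=> q0; rewrite /wave_val /transfer /= !sqrt_exp_transfer.
move: (sqrt_exp_neq0 (q * x) z) (sqrt_exp_neq0 (q' * x) z).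
set E := sqrt_exp _ _; set E' := sqrt_exp _ _ => E0 E'0.
by field; rewrite E'0 E0.
Qed.

Lemma wave_der_transfer x q q' z v : q != 0 -> q' != 0 ->
  wave_der q' z (transfer x q q' z v) x = wave_der q z v x.
Proof.
move=> q0 q'0; rewrite /wave_der /transfer /= !sqrt_exp_transfer.
move: (sqrt_exp_neq0 (q * x) z) (sqrt_exp_neq0 (q' * x) z).
set E := sqrt_exp _ _; set E' := sqrt_exp _ _ => E0 E'0.
move: q0 q'0; rewrite -!RtoC_eq0 => q0 q'0; rewrite RtoCM RtoCV.
by field; rewrite E'0 E0 q0 q'0.
Qed.

(** Value and quasi-derivative at [x] determine the coefficients, and [transfer] preserves both in
    either direction. *)
Lemma transferK x q q' z v : q != 0 -> q' != 0 ->
  transfer x q' q z (transfer x q q' z v) = v.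
Proof.
move=> q0 q'0; case: v => a b; rewrite /transfer /= !sqrt_exp_transfer.
move: (sqrt_exp_neq0 (q * x) z) (sqrt_exp_neq0 (q' * x) z).
set E := sqrt_exp _ _; set E' := sqrt_exp _ _ => E0 E'0.
move: q0 q'0; rewrite -!RtoC_eq0 => q0 q'0; rewrite !RtoCM !RtoCV.
by congr pair; field; rewrite E'0 E0 q0 q'0.
Qed.

Lemma sqrt_trig_poly_transfer x q q' (f g : C -> C) :
  sqrt_trig_poly f -> sqrt_trig_poly g ->
  sqrt_trig_poly (fun z => (transfer x q q' z (f z, g z)).1) /\
  sqrt_trig_poly (fun z => (transfer x q q' z (f z, g z)).2).
Proof.
move=> tf tg; rewrite /transfer /=; split.
  rewrite (_ : (fun _ => _) = fun z =>
    2^-1 * (1 + RtoC (q' / q)) * sqrt_exp (x * (q - q')) z * f z +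
    2^-1 * (1 - RtoC (q' / q)) * sqrt_exp (x * - (q + q')) z * g z).
    by apply: sqrt_trig_polyD; exact: sqrt_trig_polyZ.
  by apply/funext => z; ring.
rewrite (_ : (fun _ => _) = fun z =>
  2^-1 * (1 - RtoC (q' / q)) * sqrt_exp (x * (q + q')) z * f z +
  2^-1 * (1 + RtoC (q' / q)) * sqrt_exp (x * - (q - q')) z * g z).
  by apply: sqrt_trig_polyD; exact: sqrt_trig_polyZ.
by apply/funext => z; ring.
Qed.

Lemma Lmat_transfer (t q : nat -> R) k z v w :
  w = transfer (t k) (q k.-1) (q k) z v ->
  colv w.1 w.2 = Lmat t q k z *m colv v.1 v.2.
Proof.
move=> ->; apply/matrixP => i j; rewrite !mxE !big_ord_recl big_ord0 !mxE /=.
by case: i => [[|[|i]]] //= Hi; rewrite /sqrt_exp addr0; ring.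
Qed.

End Transfer.

Section Coefficients.
Variables (R : realType) (n : nat) (t q : nat -> R).
Local Notation C := R[i].
Hypothesis q0 : forall k, (k <= n)%N -> q k != 0.

Fixpoint coef_minus k z : C * C :=
  if k is k'.+1 then transfer (t k) (q k') (q k) z (coef_minus k' z) else (0, 1).

(* Indexed by the distance to the last interval: [coef_plus m] are the
   coefficients on the interval number [n - m]. *)
Fixpoint coef_plus m z : C * C :=
  if m is m'.+1 then
    transfer (t (n - m')) (q (n - m')) (q (n - m').-1) z (coef_plus m' z)
  else (1, 0).

(** [coef_plus] is built with the two [q] exchanged, that is by the inverse of [L_k]; undoing this
    step gives the forward recursion. *)
Lemma coef_plus_rec k z : (1 <= k <= n)%N ->
  coef_plus (n - k) z
    = transfer (t k) (q k.-1) (q k) z (coef_plus (n - k.-1) z).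
Proof.
case: k => // k /= kn; rewrite -(subnSK kn) /= subKn //= transferK //.
  exact: q0.
by apply: q0; exact: ltnW.
Qed.

Lemma sqrt_trig_poly_coef_minus k :
  sqrt_trig_poly (fun z => (coef_minus k z).1) /\
  sqrt_trig_poly (fun z => (coef_minus k z).2).
Proof.
elim: k => [|k [IH1 IH2]]; first by split; exact: sqrt_trig_poly_cst.
exact: (sqrt_trig_poly_transfer (t k.+1) (q k) (q k.+1) IH1 IH2).
Qed.

Lemma sqrt_trig_poly_coef_plus m :
  sqrt_trig_poly (fun z => (coef_plus m z).1) /\
  sqrt_trig_poly (fun z => (coef_plus m z).2).
Proof.
elim: m => [|m [IH1 IH2]]; first by split; exact: sqrt_trig_poly_cst.
exact: (sqrt_trig_poly_transfer (t (n - m)) (q (n - m)) (q (n - m).-1) IH1 IH2).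
Qed.

End Coefficients.

(** * Derivatives and local Lipschitz bounds of complex functions on the line *)

Section DerivativeOnTheLine.
Variable R : realType.
Local Notation C := R[i].
Implicit Types (x y : R) (f g : R -> C).

Lemma has_deriv_atP f x (l : C) : has_deriv_at f x l <->
  forall e : R, 0 < e -> exists2 d : R, 0 < d & forall h, `|h| < d ->
    cmod (f (x + h) - f x - l * RtoC h) <= e * `|h|.
Proof.
have quotE h : h != 0 -> cmod (l - (f (x + h) - f x) / RtoC h) * `|h| =
    cmod (f (x + h) - f x - l * RtoC h).
  move=> h0; rewrite -cmod_RtoC -cmodM mulrBl mulfVK ?RtoC_eq0 //.
  by rewrite -opprB cmodN.
split=> [/cvg_cmodP H e e0|H].
  have /nbhs_ballP[d /= d0 Hd] := H e e0; exists d => // h hd.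
  have [->|h0] := eqVneq h 0.
    by rewrite RtoC0 addr0 mulr0 subrr subr0 cmod_RtoC normr0 mulr0.
  rewrite -quotE // ler_wpM2r //; apply: Hd => //.
  by rewrite /ball /= sub0r normrN.
apply/cvg_cmodP => e e0; have [d d0 Hd] := H e e0.
near=> h.
have h0 : h != 0 by near: h; exact: nbhs_dnbhs_neq.
have hd : `|h| < d by near: h; exact: dnbhs0_lt.
by rewrite -(@ler_pM2r _ `|h|) ?normr_gt0 // quotE // Hd.
Unshelve. all: by end_near. Qed.

Lemma remainder_is_derive (u : R -> R) x a :
  (forall e : R, 0 < e -> exists2 d : R, 0 < d &
    forall h, `|h| < d -> `|u (x + h) - u x - a * h| <= e * `|h|) ->
  is_derive x 1 u a.
Proof.
move=> H.
suff ua : h^-1 *: ((u \o shift x) (h *: 1) - u x) @[h --> 0^'] --> a.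
  by split; [apply/cvg_ex; exists a|exact: cvg_lim ua].
apply/cvgrPdist_le => e e0; have [d d0 Hd] := H e e0.
near=> h.
have h0 : h != 0 by near: h; exact: nbhs_dnbhs_neq.
have hd : `|h| < d by near: h; exact: dnbhs0_lt.
rewrite -(@ler_pM2r _ `|h|) ?normr_gt0 // -normrM mulrBl.
rewrite -[_^-1 *: _]/(_^-1 * _) mulrAC mulVf // mul1r distrC /=.
by rewrite -[h *: 1]/(h * 1) mulr1 [h + x]addrC Hd.
Unshelve. all: by end_near. Qed.

Lemma has_deriv_at_Re f x l : has_deriv_at f x l ->
  is_derive x 1 (fun y => complex.Re (f y)) (complex.Re l).
Proof.
move=> /has_deriv_atP H; apply: remainder_is_derive => e e0.
have [d d0 Hd] := H e e0; exists d => // h /Hd; apply: le_trans.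
by apply: le_trans (Re_le_cmod _); rewrite !ReImE mulr0 subr0.
Qed.

Lemma has_deriv_at_Im f x l : has_deriv_at f x l ->
  is_derive x 1 (fun y => complex.Im (f y)) (complex.Im l).
Proof.
move=> /has_deriv_atP H; apply: remainder_is_derive => e e0.
have [d d0 Hd] := H e e0; exists d => // h /Hd; apply: le_trans.
by apply: le_trans (Im_le_cmod _); rewrite !ReImE mulr0 add0r.
Qed.

Lemma has_deriv_atD f g x l m : has_deriv_at f x l -> has_deriv_at g x m ->
  has_deriv_at (fun y => f y + g y) x (l + m).
Proof.
move=> /has_deriv_atP Hf /has_deriv_atP Hg; apply/has_deriv_atP => e e0.
have e20 : 0 < e / 2 by rewrite divr_gt0.
have [d d0 Hd] := Hf _ e20; have [d' d'0 Hd'] := Hg _ e20.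
exists (Num.min d d'); first by rewrite lt_min d0.
move=> h; rewrite lt_min => /andP[/Hd H1 /Hd' H2].
set A := cmod _ in H1; set B := cmod _ in H2.
rewrite (_ : _ - _ = (f (x + h) - f x - l * RtoC h) + (g (x + h) - g x - m * RtoC h)).
  by apply: le_trans (cmodD _ _) _; rewrite -/A -/B; lra.
by ring.
Qed.

Lemma has_deriv_atZ (c : C) f x l : has_deriv_at f x l ->
  has_deriv_at (fun y => c * f y) x (c * l).
Proof.
move=> /has_deriv_atP Hf; apply/has_deriv_atP => e e0.
(* The [+ 1] keeps the divisor positive when [c = 0]. *)
have c0 : 0 < cmod c + 1 by rewrite ltr_wpDl ?cmod_ge0.
have [d d0 Hd] := Hf _ (divr_gt0 e0 c0); exists d => // h /Hd H.
rewrite (_ : _ - _ = c * (f (x + h) - f x - l * RtoC h)); last by ring.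
rewrite cmodM; apply: le_trans (_ : (cmod c + 1) * (e / (cmod c + 1) * `|h|) <= _).
  by apply: ler_pM; rewrite ?cmod_ge0 ?lerDl.
by rewrite mulrA mulrCA divff ?gt_eqF // mulr1.
Qed.

Lemma has_deriv_at_conj f x l : has_deriv_at f x l ->
  has_deriv_at (fun y => (f y)^*) x l^*.
Proof.
move=> /has_deriv_atP H; apply/has_deriv_atP => e e0.
have [d d0 Hd] := H e e0; exists d => // h /Hd; apply: le_trans.
by rewrite -[X in _ <= X]cmodJ !rmorphB rmorphM /= RtoC_conj.
Qed.

Lemma has_deriv_at_eq f g x l (d : R) : 0 < d ->
  (forall y, `|y - x| < d -> f y = g y) ->
  has_deriv_at g x l -> has_deriv_at f x l.
Proof.
move=> d0 fg /has_deriv_atP H; apply/has_deriv_atP => e e0.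
have [d' d'0 Hd] := H e e0; exists (Num.min d d'); first by rewrite lt_min d0.
move=> h; rewrite lt_min => /andP[hd /Hd].
by rewrite !fg // ?subrr ?normr0 // addrC addKr.
Qed.

Lemma has_deriv_at_sqrt_exp (q : R) z x :
  has_deriv_at (fun y => sqrt_exp (q * y) z) x
    ('i%C * RtoC q * psqrt z * sqrt_exp (q * x) z).
Proof.
apply/has_deriv_atP => e e0; set c := 'i%C * _ * _; set E := sqrt_exp _ _.
have c0 : 0 < cmod c + 1 by rewrite ltr_wpDl ?cmod_ge0.
have E0 : 0 < cmod E by rewrite /E cmod_cexp expR_gt0.
have [d d0 Hd] := cexp_remainder (divr_gt0 e0 (mulr_gt0 E0 c0)).
exists (d / (cmod c + 1)); first by rewrite divr_gt0.
move=> h; rewrite ltr_pdivlMr // => hd.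
have ch : cmod (c * RtoC h) <= (cmod c + 1) * `|h|.
  by rewrite cmodM cmod_RtoC ler_wpM2r // lerDl.
have {}Hd := Hd (c * RtoC h) (le_lt_trans ch (_ : _ < d)).
rewrite mulrDr sqrt_expD -/E.
have -> : sqrt_exp (q * h) z = cexp (c * RtoC h).
  by rewrite /sqrt_exp /c RtoCM; congr cexp; ring.
rewrite (_ : _ - _ = E * (cexp (c * RtoC h) - 1 - c * RtoC h)); last by ring.
rewrite cmodM.
have {}Hd : cmod (cexp (c * RtoC h) - 1 - c * RtoC h) <=
   e / (cmod E * (cmod c + 1)) * ((cmod c + 1) * `|h|).
  apply: le_trans (Hd _) _; first by rewrite mulrC.
  by rewrite ler_wpM2l // divr_ge0 ?mulr_ge0 // ltW.
apply: le_trans (ler_wpM2l (ltW E0) Hd) _.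
rewrite le_eqVlt; apply/orP; left; apply/eqP; field.
by rewrite !gt_eqF.
Qed.

End DerivativeOnTheLine.

Section LocallyLipschitz.
Variable R : realType.
Local Notation C := R[i].
Implicit Types (x y : R) (f g : R -> C).

(** Stronger than local absolute continuity, but tested on pairs of points instead of families of
    intervals, and convenient for gluing at the breaks. *)
Definition loc_lipschitz f := forall a b : R, exists2 K : R, 0 <= K &
  forall x y, a <= x <= b -> a <= y <= b -> cmod (f y - f x) <= K * `|y - x|.

Lemma loc_lipschitz_abs_cont f : loc_lipschitz f -> loc_abs_cont f.
Proof.
move=> lf a b ab e e0; have [K K0 HK] := lf a b.
have K10 : 0 < K + 1 by rewrite ltr_wpDl.
exists (e / (K + 1)); first by rewrite divr_gt0.
move=> m u v Huv _; rewrite ltr_pdivlMr // => Hs.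
apply: le_lt_trans Hs.
apply: le_trans (_ : (\sum_(k < m) (v k - u k)) * K <= _).
  rewrite mulr_suml ler_sum // => k _; have [au [uv vb]] := Huv k (ltn_ord k).
  rewrite mulrC -[v k - u k]ger0_norm ?subr_ge0 //; apply: HK.
    by rewrite au (le_trans uv).
  by rewrite vb (le_trans au).
rewrite ler_wpM2l ?lerDl // sumr_ge0 // => k _.
by have [_ [uv _]] := Huv k (ltn_ord k); rewrite subr_ge0.
Qed.

Lemma loc_lipschitzD f g : loc_lipschitz f -> loc_lipschitz g ->
  loc_lipschitz (fun x => f x + g x).
Proof.
move=> lf lg a b; have [K K0 HK] := lf a b; have [L L0 HL] := lg a b.
exists (K + L); first exact: addr_ge0.
move=> x y xab yab; rewrite opprD addrACA; apply: le_trans (cmodD _ _) _.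
by rewrite mulrDl lerD ?HK ?HL.
Qed.

Lemma loc_lipschitzZ (c : C) f : loc_lipschitz f ->
  loc_lipschitz (fun x => c * f x).
Proof.
move=> lf a b; have [K K0 HK] := lf a b.
exists (cmod c * K); first by rewrite mulr_ge0 ?cmod_ge0.
by move=> x y xab yab; rewrite -mulrBr cmodM -mulrA ler_wpM2l ?cmod_ge0 ?HK.
Qed.

(** [x |-> max x s] is 1-Lipschitz and maps [[a, b]] into [[max a s, max b s]]. It produces
    corrections that are constant to the left of [s]. *)
Lemma loc_lipschitz_max f (s : R) : loc_lipschitz f ->
  loc_lipschitz (fun x => f (Num.max x s)).
Proof.
move=> lf a b; have [K K0 HK] := lf (Num.max a s) (Num.max b s).
exists K => // x y /andP[ax xb] /andP[ay yb]; apply: le_trans (HK _ _ _ _) _.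
- by rewrite !ge_max !le_max ax xb lexx !orbT.
- by rewrite !ge_max !le_max ay yb lexx !orbT.
rewrite ler_wpM2l //.
case: (leP x s); case: (leP y s); rewrite ?subrr ?normr0 // => ys xs.
- rewrite !ger0_norm; lra.
- rewrite !ler0_norm; lra.
Qed.

Lemma has_deriv_at_lipschitz f (f' : R -> C) (a b M : R) :
  (forall x, has_deriv_at f x (f' x)) ->
  (forall x, a <= x <= b -> cmod (f' x) <= M) ->
  forall x y, a <= x <= b -> a <= y <= b -> cmod (f y - f x) <= 2 * M * `|y - x|.
Proof.
move=> df bf.
suff H x y : x <= y -> a <= x <= b -> a <= y <= b ->
    cmod (f y - f x) <= 2 * M * `|y - x|.
  move=> x y xab yab; have [xy|/ltW yx] := leP x y; first exact: H.
  by rewrite -opprB cmodN distrC H.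
move=> xy /andP[ax xb] /andP[ay yb].
(* The mean value theorem fails for complex values; real and imaginary parts are treated separately,
   which costs the factor [2]. *)
have comp (u : R -> R) (u' : R -> R) : (forall s : R, is_derive s 1 u (u' s)) ->
    (forall s : R, `|u' s| <= cmod (f' s)) -> `|u y - u x| <= M * `|y - x|.
  move=> du bu; have [|c] := MVT_segment xy (fun s _ => du s).
    apply/continuous_subspaceT => s.
    apply/differentiable_continuous/derivable1_diffP.
    exact: (@ex_derive _ _ _ _ _ _ _ (du s)).
  rewrite in_itv /= => /andP[xc cy] ->; rewrite normrM ler_wpM2r //.
  by apply: le_trans (bu c) (bf _ _); rewrite (le_trans ax) // (le_trans cy).
apply: le_trans (cmod_le _) _; rewrite !ReImE.
have := comp _ _ (fun s => has_deriv_at_Re (df s)) (fun s => Re_le_cmod _).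
have := comp _ _ (fun s => has_deriv_at_Im (df s)) (fun s => Im_le_cmod _).
rewrite -mulrA; set w := M * _; set A := `|_ - _|; set B := `|_ - _|; lra.
Qed.

Lemma loc_lipschitz_sqrt_exp (q : R) z : loc_lipschitz (fun x => sqrt_exp (q * x) z).
Proof.
move=> a b; pose c := 'i%C * RtoC q * psqrt z.
(* [M] bounds [|c e^{c x}|] on [[a, b]], since [|x| <= |a| + |b|] there. *)
pose M := cmod c * expR (`|complex.Re c| * (`|a| + `|b|)).
exists (2 * M); first by rewrite mulr_ge0 // mulr_ge0 ?cmod_ge0 ?expR_ge0.
apply: (has_deriv_at_lipschitz (f' := fun x => c * sqrt_exp (q * x) z)) => x.
  exact: has_deriv_at_sqrt_exp.
move=> /andP[ax xb].
rewrite cmodM -/c ler_wpM2l ?cmod_ge0 // cmod_cexp ler_expR.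
have -> : complex.Re ('i%C * RtoC (q * x) * psqrt z) = complex.Re c * x.
  rewrite (_ : _ * _ * _ = c * RtoC x); last by rewrite /c RtoCM; ring.
  by rewrite ReM ImRtoC mulr0 subr0.
apply: le_trans (ler_norm _) _; rewrite normrM ler_wpM2l // ler_norml.
have := ler_norm b; have := normr_ge0 b; have := normr_ge0 a.
have : - `|a| <= a by rewrite lerNl -normrN ler_norm.
by move=> *; apply/andP; split; lra.
Qed.

Lemma loc_lipschitz_wave_val (q : R) z v : loc_lipschitz (wave_val q z v).
Proof.
apply: loc_lipschitzD; apply: loc_lipschitzZ; first exact: loc_lipschitz_sqrt_exp.
rewrite (_ : (fun _ => _) = fun x => sqrt_exp (- q * x) z).
  exact: loc_lipschitz_sqrt_exp.
by apply/funext => x; rewrite mulNr sqrt_expN.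
Qed.

(** Differentiating a wave flips the sign of its second coefficient up to a scalar, so regularity of
    [wave_der] follows from that of [wave_val]. *)
Lemma wave_derE (q : R) z v x :
  wave_der q z v x = (RtoC q)^-1 * wave_val q z (v.1, - v.2) x.
Proof. by rewrite /wave_der /wave_val /= mulNr. Qed.

Lemma loc_lipschitz_wave_der (q : R) z v : loc_lipschitz (wave_der q z v).
Proof.
rewrite (_ : wave_der q z v = fun x => (RtoC q)^-1 * wave_val q z (v.1, - v.2) x).
  exact/loc_lipschitzZ/loc_lipschitz_wave_val.
by apply/funext => x; exact: wave_derE.
Qed.

Lemma has_deriv_at_wave_val (q : R) z v x :
  has_deriv_at (wave_val q z v) x
    ('i%C * RtoC q * psqrt z * wave_val q z (v.1, - v.2) x).
Proof.
rewrite (_ : _ * wave_val _ _ _ _ =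
  v.1 * ('i%C * RtoC q * psqrt z * sqrt_exp (q * x) z) +
  v.2 * ('i%C * RtoC (- q) * psqrt z * sqrt_exp (- q * x) z)); last first.
  by rewrite /wave_val /= RtoCN [- q * x]mulNr sqrt_expN; ring.
rewrite (_ : wave_val q z v =
    fun y => v.1 * sqrt_exp (q * y) z + v.2 * sqrt_exp (- q * y) z).
  by apply: has_deriv_atD; apply: has_deriv_atZ; exact: has_deriv_at_sqrt_exp.
by apply/funext => y; rewrite mulNr sqrt_expN.
Qed.

Lemma has_deriv_at_wave_der (q : R) z v x : q != 0 ->
  has_deriv_at (wave_der q z v) x ('i%C * psqrt z * wave_val q z v x).
Proof.
rewrite -RtoC_eq0 => q0.
rewrite (_ : _ * wave_val _ _ _ _ = (RtoC q)^-1 *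
  ('i%C * RtoC q * psqrt z * wave_val q z (v.1, - - v.2) x)).
  rewrite (_ : wave_der q z v = fun x => (RtoC q)^-1 * wave_val q z (v.1, - v.2) x).
    apply: has_deriv_atZ; exact: (@has_deriv_at_wave_val q z (v.1, - v.2)).
  by apply/funext => y; exact: wave_derE.
by rewrite opprK -surjective_pairing; field.
Qed.

End LocallyLipschitz.

(** * Functions given by one formula on each interval *)

Section Piecewise.
Variables (R : realType) (t : nat -> R).
Implicit Types (F : nat -> R -> R[i]).

(** The largest [k] in [1..n] with [t k < x], or [0]; the strict test matches the intervals closed
    on the right. Recursion on the number of breaks lets gluing proceed by adding the last break. *)
Fixpoint interval_index n (x : R) : nat :=
  if n is n'.+1 then if t n < x then n else interval_index n' x else 0.

Definition piecewise n F x := F (interval_index n x) x.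

Definition breaks_increasing n :=
  forall j, (1 <= j)%N -> (j < n)%N -> t j < t j.+1.

Lemma breaks_increasingS n : breaks_increasing n.+1 -> breaks_increasing n.
Proof. by move=> tn j j1 jn; apply: tn => //; exact: ltnW. Qed.

Lemma interval_index_le n x : (interval_index n x <= n)%N.
Proof. by elim: n => //= n IH; case: ifP => // _; exact: leqW. Qed.

Lemma interval_index_last n x : breaks_increasing n.+1 -> t n.+1 < x ->
  interval_index n x = n.
Proof. by case: n => //= n tn tx; rewrite (lt_trans (tn n.+1 _ _) tx). Qed.

Lemma interval_indexP n x k : breaks_increasing n -> (1 <= k <= n)%N ->
  (t k < x) = (k <= interval_index n x)%N.
Proof.
elim: n k => [|n IH] k tn; first by case: k.
rewrite [(k <= n.+1)%N]leq_eqVlt ltnS => /andP[k1 /orP[/eqP ->|kn]] /=.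
  by case: ifP => [|_]; rewrite ?leqnn // ltnNge interval_index_le.
rewrite (IH k (breaks_increasingS tn)) ?k1 //.
case: ifP => // /(interval_index_last tn) ->.
by rewrite kn leqW.
Qed.

Lemma Ij_interval_index n x j : (1 <= n)%N -> breaks_increasing n ->
  (j <= n)%N -> \1_(Ij n t j) x = (j == interval_index n x)%:R :> R.
Proof.
move=> n1 tn jn; rewrite indicE; congr (_%:R); congr nat_of_bool.
have idx_le := interval_index_le n x.
apply/idP/idP; rewrite inE /Ij.
  case: eqP => [->|/eqP j0] /=.
    rewrite leNgt (interval_indexP (n := n)) ?n1 //.
    by rewrite -leqNgt leqn0 eq_sym.
  case: eqP => [->|/eqP jn'] /=.
    by rewrite (interval_indexP (n := n)) ?n1 ?leqnn // eqn_leq idx_le andbT.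
  have {}jn : (j < n)%N by rewrite ltn_neqAle jn' jn.
  rewrite leNgt !(interval_indexP (n := n)) ?jn ?lt0n ?j0 ?(ltnW jn) //.
  by rewrite -leqNgt => -[H1 H2]; rewrite eqn_leq H1.
move=> /eqP jE; have tj k : (1 <= k <= n)%N -> (t k < x) = (k <= j)%N.
  by move=> kn; rewrite jE (interval_indexP (n := n)).
case: eqP => [j0|/eqP j0] /=; first by rewrite leNgt tj ?n1 // j0.
case: eqP => [jn'|/eqP jn'] /=; first by rewrite tj ?n1 ?leqnn // jn'.
have {}jn : (j < n)%N by rewrite ltn_neqAle jn' jn.
by rewrite leNgt !tj ?jn ?lt0n ?j0 ?(ltnW jn) // ltnn.
Qed.

(** The map [c] is kept abstract to cover both the real sum in [pfun] and the sum in [Phi], where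
    indicators pass through [RtoC]. *)
Lemma sum_Ij n (V : pzRingType) (F : nat -> V) (c : R -> V) x : (1 <= n)%N ->
  breaks_increasing n -> c 0 = 0 -> c 1 = 1 ->
  \sum_(0 <= j < n.+1) c (\1_(Ij n t j) x) * F j = F (interval_index n x).
Proof.
move=> n1 tn c0 c1; have idx_le := interval_index_le n x.
rewrite big_mkord (bigD1 (Ordinal (idx_le : (_ < n.+1)%N))) //=.
rewrite Ij_interval_index // eqxx c1 mul1r big1 ?addr0 // => j jx.
rewrite Ij_interval_index //; last by rewrite -ltnS.
by rewrite (negbTE (_ : val j != _)) ?c0 ?mul0r.
Qed.

(* On crossing [t k] the function changes by [F k - F k.-1], which vanishes at
   [t k]; precomposed with [max _ (t k)] this increment is Lipschitz on the line. *)
Lemma loc_lipschitz_piecewise n F : breaks_increasing n ->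
  (forall k, loc_lipschitz (F k)) ->
  (forall k, (1 <= k <= n)%N -> F k (t k) = F k.-1 (t k)) ->
  loc_lipschitz (piecewise n F).
Proof.
move=> tn lF; elim: n tn => [_ _|n IH tn mF]; first exact: lF.
rewrite (_ : piecewise n.+1 F = fun x => piecewise n F x +
    (F n.+1 (Num.max x (t n.+1)) + -1 * F n (Num.max x (t n.+1)))).
  apply: loc_lipschitzD.
    apply: IH; first exact: breaks_increasingS.
    by move=> k /andP[k1 kn]; apply: mF; rewrite k1 leqW.
  apply: (@loc_lipschitz_max _ (fun x => F n.+1 x + -1 * F n x)).
  by apply: loc_lipschitzD => //; exact: loc_lipschitzZ.
apply/funext => x; rewrite /piecewise /=; case: ltP => tx.
  by rewrite (interval_index_last tn) //; ring.
by rewrite (mF n.+1) ?leqnn //=; ring.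
Qed.

Lemma interval_index_locally_cst n x :
  (forall k, (1 <= k <= n)%N -> x != t k) ->
  exists2 d, 0 < d &
    forall y, `|y - x| < d -> interval_index n y = interval_index n x.
Proof.
elim: n => [|n IH] xt; first by exists 1.
have [|d d0 Hd] := IH.
  by move=> k /andP[k1 kn]; apply: xt; rewrite k1 leqW.
exists (Num.min d `|t n.+1 - x|).
  by rewrite lt_min d0 normr_gt0 subr_eq0 eq_sym xt // leqnn.
move=> y; rewrite lt_min => /andP[yd yt] /=; rewrite (Hd y yd).
suff -> : (t n.+1 < y) = (t n.+1 < x) by [].
have := xt n.+1; rewrite leqnn => /(_ isT); rewrite neq_lt => /orP[] H.
- move: yt; rewrite (gtr0_norm (_ : 0 < t n.+1 - x)) ?subr_gt0 //.
  rewrite ltr_norml => /andP[_ ?]; rewrite [RHS]ltNge (ltW H) /=.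
  by apply/negbTE; rewrite -leNgt; lra.
- move: yt; rewrite (ltr0_norm (_ : t n.+1 - x < 0)) ?subr_lt0 //.
  by rewrite ltr_norml => /andP[? _]; rewrite H; lra.
Qed.

Lemma has_deriv_at_piecewise n F x l :
  (forall k, (1 <= k <= n)%N -> x != t k) ->
  has_deriv_at (F (interval_index n x)) x l -> has_deriv_at (piecewise n F) x l.
Proof.
move=> /interval_index_locally_cst[d d0 Hd]; apply: (has_deriv_at_eq d0) => y yd.
by rewrite /piecewise Hd.
Qed.

Lemma ae_not_break n :
  {ae (@lebesgue_measure R), forall x, forall k, (1 <= k <= n)%N -> x != t k}.
Proof.
have ct : countable [set t k | k in `I_n.+1].
  by apply/finite_set_countable/finite_image/finite_II.
have mt : measurable [set t k | k in `I_n.+1].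
  by apply: countable_measurable => // r; exact: measurable_set1.
exists [set t k | k in `I_n.+1]; split => //; first exact: countable_lebesgue_measure0.
move=> x /= /existsNP[k /not_implyP[/andP[k1 kn]]] /negP/negPn/eqP ->.
by exists k.
Qed.

End Piecewise.

Lemma ae_imply (R : realType) (P Q : R -> Prop) : (forall x, P x -> Q x) ->
  {ae (@lebesgue_measure R), forall x, P x} ->
  {ae (@lebesgue_measure R), forall x, Q x}.
Proof.
move=> PQ [A [mA A0 PA]]; exists A; split => // x nQx.
by apply: PA => Px; exact/nQx/PQ.
Qed.

(** * Matched waves are solutions *)

Section Solutions.
Variables (R : realType) (n : nat) (t pc : nat -> R).
Hypothesis n1 : (1 <= n)%N.
Hypothesis tn : breaks_increasing t n.
Hypothesis pc0 : forall j, (j <= n)%N -> 0 < pc j.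
Local Notation C := R[i].
Local Notation q := (qcoef pc).
Implicit Types (z : C) (v : nat -> C * C).

Lemma qcoef_gt0 k : (k <= n)%N -> 0 < q k.
Proof. by move=> kn; rewrite invr_gt0 sqrtr_gt0 pc0. Qed.

Lemma qcoef_neq0 k : (k <= n)%N -> q k != 0.
Proof. by move=> kn; rewrite gt_eqF ?qcoef_gt0. Qed.

Lemma pc_qcoef k : (k <= n)%N -> pc k = (q k)^-1 ^+ 2.
Proof. by move=> kn; rewrite invrK sqr_sqrtr // ltW ?pc0. Qed.

Definition wave v z := piecewise t n (fun k => wave_val (q k) z (v k)).

Lemma PhiE (a b : nat -> C -> C) z :
  Phi n t q a b z = wave (fun k => (a k z, b k z)) z.
Proof.
apply/funext => x; rewrite /wave /piecewise.
rewrite -(@sum_Ij _ t n _ (fun k => wave_val (q k) z (a k z, b k z) x) (@RtoC R)) //.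
apply: eq_bigr => k _; rewrite /wave_val /= cexpN.
suff -> : cexp ('i%C * RtoC (q k) * psqrt z * RtoC x) = sqrt_exp (q k * x) z by [].
by rewrite /sqrt_exp RtoCM; congr cexp; ring.
Qed.

Lemma pfunE x : pfun n t pc x = pc (interval_index t n x).
Proof.
rewrite -(@sum_Ij _ t n _ pc id) //.
by apply: eq_bigr => k _; rewrite mulrC.
Qed.

(** Continuity of [f] and [p f'] at all breaks, stated on coefficients. This is the common interface
    of both families: their opposite directions of construction no longer matter. *)
Definition matched v z := forall k, (1 <= k <= n)%N ->
  v k = transfer (t k) (q k.-1) (q k) z (v k.-1).

Lemma wave_solution v z : matched v z -> is_solution (pfun n t pc) z (wave v z).
Proof.
move=> mv.
have q0 k : (1 <= k <= n)%N -> q k != 0 /\ q k.-1 != 0.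
  by case: k => // k /= kn; rewrite !qcoef_neq0 // ltnW.
split.
  apply/loc_lipschitz_abs_cont/loc_lipschitz_piecewise => // [k|k kn].
    exact: loc_lipschitz_wave_val.
  by rewrite mv // wave_val_transfer; case: (q0 k kn).
(* This is [p f'] off the breaks, with the normalising factor [i sqrt z] restored; unlike [f'], it
   extends continuously across them. *)
exists (fun x => 'i%C * psqrt z *
  piecewise t n (fun k => wave_der (q k) z (v k)) x); split.
- apply/loc_lipschitz_abs_cont/loc_lipschitzZ/loc_lipschitz_piecewise => // [k|k kn].
    exact: loc_lipschitz_wave_der.
  by rewrite mv // wave_der_transfer; case: (q0 k kn).
- apply: ae_imply (ae_not_break t n) => x xt; rewrite pfunE.
  have := interval_index_le t n x; set j := interval_index t n x => jn.
  exists ('i%C * RtoC (q j) * psqrt z * wave_val (q j) z ((v j).1, - (v j).2) x).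
  split; first by apply: has_deriv_at_piecewise => //; exact: has_deriv_at_wave_val.
  rewrite /piecewise -/j wave_derE pc_qcoef // expr2 !RtoCM RtoCV.
  have := qcoef_neq0 jn; rewrite -RtoC_eq0 => qj0.
  by field.
- apply: ae_imply (ae_not_break t n) => x xt.
  have := interval_index_le t n x; set j := interval_index t n x => jn.
  (* The equation reduces to [(i sqrt z)^2 = -z]. *)
  rewrite (_ : - _ = 'i%C * psqrt z * ('i%C * psqrt z * wave_val (q j) z (v j) x)).
    apply: has_deriv_atZ; apply: has_deriv_at_piecewise => //.
    by apply: has_deriv_at_wave_der; exact: qcoef_neq0.
  rewrite /wave /piecewise -/j -{1}(sqr_psqrt z).
  transitivity ('i%C ^+ 2 * (psqrt z * psqrt z * wave_val (q j) z (v j) x)).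
    by rewrite sqr_i mulN1r.
  by ring.
Qed.

(** Since [p] is real, conjugation commutes with the operator. *)
Lemma is_solution_conj (p : R -> R) z (f : R -> C) :
  is_solution p z f -> is_solution p z^* (fun x => (f x)^*).
Proof.
have ac_conj (h : R -> C) : loc_abs_cont h -> loc_abs_cont (fun x => (h x)^*).
  move=> hac a b ab e e0; have [d d0 Hd] := hac a b ab e e0; exists d => //.
  move=> m u w H1 H2 H3.
  rewrite (eq_bigr (fun k : 'I_m => cmod (h (w k) - h (u k)))); first exact: Hd.
  by move=> k _; rewrite -rmorphB cmodJ.
move=> [fac [g [gac df dg]]]; split; first exact: ac_conj.
exists (fun x => (g x)^*); split; first exact: ac_conj.
- apply: ae_imply df => x [l [fl gE]]; exists l^*.
  split; first exact: has_deriv_at_conj.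
  by rewrite gE rmorphM /= RtoC_conj.
- by apply: ae_imply dg => x /has_deriv_at_conj; rewrite rmorphN rmorphM.
Qed.

End Solutions.

(** * Energy and linear independence in the upper half plane *)

Section Energy.
Variable R : realType.
Local Notation C := R[i].
Implicit Types (q x : R) (z : C) (v : C * C).

(** From [Im z = 2 Re (sqrt z) Im (sqrt z)] and [Re (sqrt z) > 0]. *)
Lemma Im_psqrt_gt0 z : 0 < complex.Im z -> 0 < complex.Im (psqrt z).
Proof.
move=> z0; have sz : slit z by move=> [z0' _]; move: z0; rewrite z0' ltxx.
have r0 := Re_psqrt_gt0 sz; have : complex.Im (psqrt z * psqrt z) = complex.Im z.
  by rewrite sqr_psqrt.
rewrite ImM => E; rewrite -(pmulr_rgt0 _ r0); lra.
Qed.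

(** The product of the first three factors is [p f']. *)
Definition energy q z v x : R :=
  complex.Im ('i%C * psqrt z * wave_der q z v x * (wave_val q z v x)^*).

(** In the derivative of [p f' conj f] the term [p |f'|^2] is real, so only the imaginary part of
    [-z |f|^2] survives. *)
Lemma is_derive_energy q z v x : q != 0 ->
  is_derive x 1 (energy q z v) (- complex.Im z * cmod (wave_val q z v x) ^+ 2).
Proof.
move=> q0.
pose f := wave_val q z v; pose g y := 'i%C * psqrt z * wave_der q z v y.
have df : has_deriv_at f x (RtoC (q ^+ 2) * g x).
  rewrite (_ : _ * _ = 'i%C * RtoC q * psqrt z * wave_val q z (v.1, - v.2) x).
    exact: has_deriv_at_wave_val.
  rewrite /g wave_derE expr2 RtoCM; move: q0; rewrite -RtoC_eq0 => q0; by field.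
have dg : has_deriv_at g x (- (z * f x)).
  rewrite (_ : - _ = 'i%C * psqrt z * ('i%C * psqrt z * f x)).
    exact/has_deriv_atZ/has_deriv_at_wave_der.
  rewrite -{1}(sqr_psqrt z).
  transitivity ('i%C ^+ 2 * (psqrt z * psqrt z * f x)); last by ring.
  by rewrite sqr_i mulN1r.
have dfR := has_deriv_at_Re df; have dfI := has_deriv_at_Im df.
have dgR := has_deriv_at_Re dg; have dgI := has_deriv_at_Im dg.
have -> : energy q z v = (fun y => complex.Im (g y)) * (fun y => complex.Re (f y))
    - (fun y => complex.Re (g y)) * (fun y => complex.Im (f y)).
  apply/funext => y; rewrite /energy -/(g y) -/(f y) ImM Re_conj Im_conj.
  by rewrite mulrN addrC.
apply: is_derive_eq.
rewrite -[wave_val q z v x]/(f x); move: (f x) (g x) => w u.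
rewrite sqr_cmod !(ReM, ImM, ReN, ImN) ReRtoC ImRtoC.
by rewrite -![_ *: _]/(_ * _); ring.
Qed.

Lemma energy_nincr q z v x y : q != 0 -> 0 <= complex.Im z -> x <= y ->
  energy q z v y <= energy q z v x.
Proof.
move=> q0 z0 xy; have de s := is_derive_energy z v s q0.
apply: (@ler0_derive1_nincr _ _ x y) => // [s _|].
- rewrite derive1E (@derive_val _ _ _ _ _ _ _ (de s)) mulNr oppr_le0.
  by rewrite mulr_ge0 ?sqr_ge0.
- apply/continuous_subspaceT => s; apply/differentiable_continuous/derivable1_diffP.
  exact: (@ex_derive _ _ _ _ _ _ _ (de s)).
Qed.

(** A single exponential satisfies [p f' = -i q^-1 sqrt z f], or the same with [+i] for the other
    direction, so the sign of its energy is decided by [Re (sqrt z)]. *)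
Lemma energy_left q z b x : energy q z (0, b) x =
  - (q^-1 * complex.Re (psqrt z) * cmod (wave_val q z (0, b) x) ^+ 2).
Proof.
rewrite /energy wave_derE /wave_val ![fst _]/= ![snd _]/= !mul0r !add0r.
set w := b * _; have -> : - b * (sqrt_exp (q * x) z)^-1 = - w by rewrite mulNr.
by move: w (psqrt z) => w s; rewrite sqr_cmod -RtoCV !ReImE; ring.
Qed.

Lemma energy_right q z a x : energy q z (a, 0) x =
  q^-1 * complex.Re (psqrt z) * cmod (wave_val q z (a, 0) x) ^+ 2.
Proof.
rewrite /energy wave_derE /wave_val ![fst _]/= ![snd _]/= oppr0 !mul0r !addr0.
by move: (a * _) (psqrt z) => w s; rewrite sqr_cmod -RtoCV !ReImE; ring.
Qed.

Lemma energy_transfer x q q' z v : q != 0 -> q' != 0 ->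
  energy q' z (transfer x q q' z v) x = energy q z v x.
Proof. by move=> q0 q'0; rewrite /energy wave_der_transfer // wave_val_transfer. Qed.

End Energy.

Section Independence.
Variables (R : realType) (n : nat) (t pc : nat -> R).
Hypothesis n1 : (1 <= n)%N.
Hypothesis tn : breaks_increasing t n.
Hypothesis pc0 : forall j, (j <= n)%N -> 0 < pc j.
Local Notation C := R[i].
Local Notation q := (qcoef pc).
Implicit Types (z : C) (v : nat -> C * C).

Lemma coef_minus_neq0 v z : 0 < complex.Im z -> matched n t pc v z ->
  v 0%N = (0, 1) -> (v n).2 != 0.
Proof.
move=> z0 mv v0.
have q0 k : (k <= n)%N -> q k != 0 by exact: qcoef_neq0.
have sz : slit z by move=> [z0' _]; move: z0; rewrite z0' ltxx.
have e1 : energy (q 0%N) z (v 0%N) (t 1%N) < 0.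
  rewrite v0 energy_left oppr_lt0 mulr_gt0 //.
    by rewrite mulr_gt0 ?Re_psqrt_gt0 // invr_gt0; exact: qcoef_gt0 (leq0n n).
  rewrite exprn_gt0 // /wave_val /= mul0r add0r mul1r cmodV invr_gt0 cmod_cexp.
  exact: expR_gt0.
(* Negativity passes through each break unchanged and can only be strengthened along the next
   interval. *)
have ek k : (k < n)%N -> energy (q k.+1) z (v k.+1) (t k.+1) < 0.
  elim: k => [|k IH] kn.
    by rewrite mv ?n1 // energy_transfer ?q0.
  rewrite mv ?kn // energy_transfer /=; [|exact/q0/ltnW|exact: q0].
  apply: le_lt_trans (IH (ltnW kn)).
  by apply: energy_nincr; rewrite ?q0 ?(ltW z0) ?(ltW (tn _ _)) // ltnW.
(* This is the energy of the last wave at the left end [t n] of its interval, where [energy_right]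
   would make it nonnegative. *)
have := ek n.-1; rewrite prednK // leqnn => /(_ isT).
case: (v n) => a b /=; apply: contraTneq => ->; rewrite energy_right -leNgt.
apply: mulr_ge0 (sqr_ge0 _); apply: mulr_ge0 (Re_psqrt_ge0 _).
by rewrite invr_ge0 ltW //; exact: qcoef_gt0 (leqnn n).
Qed.

Lemma wave_right v z x : t n < x -> wave n t pc v z x = wave_val (q n) z (v n) x.
Proof. by case: n n1 => // m _ tx; rewrite /wave /piecewise /= tx. Qed.

Lemma wave_left v z x : x <= t 1%N -> wave n t pc v z x = wave_val (q 0%N) z (v 0%N) x.
Proof.
move=> xt; rewrite /wave /piecewise.
suff -> : interval_index t n x = 0%N by [].
by apply/eqP; rewrite -leqn0 leqNgt -(interval_indexP _ tn) ?n1 // -leNgt.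
Qed.

Lemma cmod_sqrt_exp (s : R) z :
  cmod (sqrt_exp s z) = expR (- (s * complex.Im (psqrt z))).
Proof.
by rewrite cmod_cexp; move: (psqrt z) => w; congr expR; rewrite !ReImE; ring.
Qed.

Lemma wave_independent v w z (al be : C) : 0 < complex.Im z ->
  matched n t pc w z -> v n = (1, 0) -> w 0%N = (0, 1) ->
  (forall x, al * wave n t pc v z x + be * wave n t pc w z x = 0) ->
  al = 0 /\ be = 0.
Proof.
move=> z0 mw vn w0 H; have b0 := coef_minus_neq0 z0 mw w0.
case wn : (w n) b0 => [a b] /= b0.
pose E x := sqrt_exp (q n * x) z.
(* The vanishing combination on the last interval, multiplied by [E x]. *)
have {}H x : t n < x -> (al + be * a) * E x ^+ 2 = - (be * b).
  move=> tx; have := H x; rewrite !wave_right // vn wn /wave_val /= -/(E x) => Hx.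
  have Ex : E x != 0 by exact: sqrt_exp_neq0.
  apply/eqP; rewrite -subr_eq0 opprK; apply/eqP.
  transitivity (E x * 0); last by rewrite mulr0.
  by rewrite -Hx; field.
(* The right side above is constant in [x], whereas [|E x|] strictly decreases because
   [Im (sqrt z) > 0]; two sample points suffice. *)
have E12 : E (t n + 1) ^+ 2 != E (t n + 2) ^+ 2.
  apply/eqP => /(congr1 (@cmod R)); rewrite !expr2 !cmodM -!expr2 => /eqP.
  rewrite eqrXn2 ?cmod_ge0 // !cmod_sqrt_exp (inj_eq (@expR_inj R)).
  have i0 : complex.Im (psqrt z) != 0 by rewrite gt_eqF // Im_psqrt_gt0.
  have qn0 : q n != 0 by exact: qcoef_neq0 (leqnn n).
  by rewrite eqr_opp (inj_eq (mulIf i0)) (inj_eq (mulfI qn0)); lra.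
have t1 : t n < t n + 1 by lra.
have t2 : t n < t n + 2 by lra.
have A0 : al + be * a = 0.
  apply/eqP; have /eqP : (al + be * a) * (E (t n + 1) ^+ 2 - E (t n + 2) ^+ 2) = 0.
    by rewrite mulrBr !H // subrr.
  by rewrite mulf_eq0 subr_eq0 (negbTE E12) orbF.
have be0 : be = 0.
  have /esym/eqP := H _ t1; rewrite A0 mul0r oppr_eq0 mulf_eq0 (negbTE b0) orbF.
  by move/eqP.
by split=> //; move: A0; rewrite be0 mul0r addr0.
Qed.

End Independence.

(** * Square integrability of decaying exponentials *)

Section SquareIntegrability.
Variable R : realType.
Local Notation C := R[i].
Local Notation mu := (@lebesgue_measure R).
Implicit Types (k c x : R) (z : C).

Lemma is_derive_expRM k x : is_derive x 1 (fun y => expR (k * y)) (k * expR (k * x)).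
Proof.
have dk : is_derive x 1 (fun y : R => k * y) k.
  rewrite (_ : (fun _ => _) = k *: (@id R)) //.
  by apply: is_derive_eq; rewrite -[_ *: _]/(k * 1) mulr1.
have := is_derive1_comp (is_derive_expR (k * x)) dk.
by rewrite mulrC.
Qed.

Lemma continuous_expRM k : continuous (fun y : R => expR (k * y)).
Proof.
move=> x; apply/differentiable_continuous/derivable1_diffP.
exact: (@ex_derive _ _ _ _ _ _ _ (is_derive_expRM k x)).
Qed.

Lemma integral_expR_right k c : 0 < k ->
  (\int[mu]_(x in `[c, +oo[) (expR (- k * x))%:E < +oo)%E.
Proof.
move=> k0; have kn0 : k != 0 by rewrite gt_eqF.
pose F x := - k^-1 * expR (- k * x).
have dF x : is_derive x 1 F (expR (- k * x)).
  have -> : F = - k^-1 *: (fun x => expR (- k * x)) by [].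
  have dE := is_derive_expRM (- k) x; apply: is_derive_eq.
  by rewrite -[_ *: _]/(_ * _) mulrA mulrNN mulVf // mul1r.
rewrite (@ge0_continuous_FTC2y _ _ F c 0).
- by rewrite sub0e -EFinN ltry.
- by move=> x _; exact: expR_ge0.
- exact/continuous_subspaceT/continuous_expRM.
- rewrite -(mulr0 (- k^-1)); apply: cvgM; first exact: cvg_cst.
  have ky : k * x @[x --> +oo] --> +oo by apply: gt0_cvgMry.
  apply: cvg_trans (cvg_comp _ _ ky (@cvgr_expR R)).
  by apply: near_eq_cvg; near=> x; rewrite /= mulNr.
- by move=> x _; exact: (@ex_derive _ _ _ _ _ _ _ (dF x)).
- apply: cvg_at_right_filter; apply/differentiable_continuous/derivable1_diffP.
  exact: (@ex_derive _ _ _ _ _ _ _ (dF c)).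
- by move=> x _; rewrite derive1E (@derive_val _ _ _ _ _ _ _ (dF x)).
Unshelve. all: by end_near. Qed.

Lemma integral_expR_left k c : 0 < k ->
  (\int[mu]_(x in `]-oo, c]) (expR (k * x))%:E < +oo)%E.
Proof.
move=> k0; rewrite -[c]opprK ge0_integration_by_substitutionNy.
- under eq_integral => x _ do rewrite /= mulrN -mulNr.
  exact: integral_expR_right.
- exact/continuous_subspaceT/continuous_expRM.
- by move=> x _; exact: expR_ge0.
Qed.

Lemma measurable_sqrt_exp (q : R) z (A : set R) :
  measurable_fun A (fun x => complex.Re (sqrt_exp (q * x) z)) /\
  measurable_fun A (fun x => complex.Im (sqrt_exp (q * x) z)).
Proof.
have dE x := @has_deriv_at_sqrt_exp R q z x.
split; apply: measurable_funTS; apply: continuous_measurable_fun => x;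
  apply/differentiable_continuous/derivable1_diffP.
  exact: (@ex_derive _ _ _ _ _ _ _ (has_deriv_at_Re (dE x))).
exact: (@ex_derive _ _ _ _ _ _ _ (has_deriv_at_Im (dE x))).
Qed.

(** [|e^{i q sqrt z x}|^2 = e^{-2 q Im (sqrt z) x}]. The sign of [q] is left free: positive at the
    right end, negative at the left end. *)
Lemma L2_on_sqrt_exp (A : set R) (q : R) z (f : R -> C) :
  (forall x, A x -> f x = sqrt_exp (q * x) z) ->
  (\int[mu]_(x in A) (expR (- (2 * q * complex.Im (psqrt z)) * x))%:E < +oo)%E ->
  L2_on A f.
Proof.
move=> fE iA; have [mR mI] := measurable_sqrt_exp q z A; split.
- by apply: eq_measurable_fun mR => x /set_mem/fE ->.
- by apply: eq_measurable_fun mI => x /set_mem/fE ->.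
rewrite (_ : (\int[mu]_(x in A) _ = \int[mu]_(x in A)
  (expR (- (2 * q * complex.Im (psqrt z)) * x))%:E)%E) //.
apply: eq_integral => x /set_mem/fE ->; rewrite cmod_sqrt_exp expr2 -expRD.
congr (expR _)%:E.
by ring.
Qed.

Lemma lies_right_L2_sqrt_exp c (q : R) z (f : R -> C) :
  0 < q -> 0 < complex.Im (psqrt z) ->
  (forall x, c <= x -> f x = sqrt_exp (q * x) z) -> lies_right_L2 f.
Proof.
move=> q0 s0 fE; exists c; rewrite (_ : [set x | c <= x] = `[c, +oo[%classic).
  apply: (@L2_on_sqrt_exp _ q z) => [x|].
    by rewrite /= in_itv /= andbT; exact: fE.
  by apply: integral_expR_right; apply: mulr_gt0 => //; exact: mulr_gt0.
by apply/seteqP; split => x /=; rewrite in_itv /= andbT.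
Qed.

Lemma lies_left_L2_sqrt_exp c (q : R) z (f : R -> C) :
  0 < q -> 0 < complex.Im (psqrt z) ->
  (forall x, x <= c -> f x = (sqrt_exp (q * x) z)^-1) -> lies_left_L2 f.
Proof.
move=> q0 s0 fE; exists c; rewrite (_ : [set x | x <= c] = `]-oo, c]%classic).
  apply: (@L2_on_sqrt_exp _ (- q) z) => [x|].
    by rewrite /= in_itv /= mulNr sqrt_expN; exact: fE.
  rewrite mulrN mulNr opprK.
  by apply: integral_expR_left; apply: mulr_gt0 => //; exact: mulr_gt0.
by apply/seteqP; split => x /=; rewrite in_itv.
Qed.

Lemma L2_on_conj (A : set R) (f : R -> C) : L2_on A f -> L2_on A (fun x => (f x)^*).
Proof.
move=> [mR mI iA]; split.
- by under eq_fun do rewrite Re_conj.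
- by under eq_fun do rewrite Im_conj; exact: measurableT_comp.
- by under eq_integral do rewrite cmodJ.
Qed.

End SquareIntegrability.

Lemma sqrt_trig_poly_wave_val (R : realType) (q x : R) (f g : R[i] -> R[i]) :
  sqrt_trig_poly f -> sqrt_trig_poly g ->
  sqrt_trig_poly (fun z => wave_val q z (f z, g z) x).
Proof.
move=> tf tg; rewrite (_ : (fun _ => _) = fun z =>
  1 * sqrt_exp (q * x) z * f z + 1 * sqrt_exp (- (q * x)) z * g z).
  by apply: sqrt_trig_polyD; exact: sqrt_trig_polyZ.
by apply/funext => z; rewrite /wave_val /= sqrt_expN; ring.
Qed.

Unset Implicit Arguments.

Theorem theorem3p1 (R : realType) (n : nat) (t pc : nat -> R) :
  (1 <= n)%N ->
  (forall j, (1 <= j)%N -> (j < n)%N -> t j < t j.+1) ->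
  (forall j, (j <= n)%N -> 0 < pc j) ->
  exists ap bp am bm : nat -> R[i] -> R[i],
    (* conventions a_n^+ = 1, b_n^+ = 0, a_0^- = 0, b_0^- = 1 *)
    (forall z, [/\ ap n z = 1, bp n z = 0, am 0%N z = 0 & bm 0%N z = 1]) /\
    (* analyticity of the coefficients *)
    (forall l, (l < n)%N -> holo_on slit (ap l) /\ holo_on slit (bp l)) /\
    (forall j, (1 <= j <= n)%N -> holo_on slit (am j) /\ holo_on slit (bm j)) /\
    (* Phi^+ and Phi^- are solutions, depending analytically on z *)
    (forall z, slit z ->
       is_solution (pfun n t pc) z (Phi n t (qcoef pc) ap bp z) /\
       is_solution (pfun n t pc) z (Phi n t (qcoef pc) am bm z)) /\
    (forall x : R,
       holo_on slit (fun z => Phi n t (qcoef pc) ap bp z x) /\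
       holo_on slit (fun z => Phi n t (qcoef pc) am bm z x)) /\
    (* Im z > 0 *)
    (forall z : R[i], 0 < complex.Im z ->
       [/\ fundamental_system (pfun n t pc) z
             (Phi n t (qcoef pc) ap bp z) (Phi n t (qcoef pc) am bm z),
           lies_right_L2 (Phi n t (qcoef pc) ap bp z) &
           lies_left_L2 (Phi n t (qcoef pc) am bm z)]) /\
    (* Im z < 0 *)
    (forall z : R[i], complex.Im z < 0 ->
       [/\ fundamental_system (pfun n t pc) z
             (fun x => (Phi n t (qcoef pc) ap bp z^* x)^*)
             (fun x => (Phi n t (qcoef pc) am bm z^* x)^*),
           lies_right_L2 (fun x => (Phi n t (qcoef pc) ap bp z^* x)^*) &
           lies_left_L2 (fun x => (Phi n t (qcoef pc) am bm z^* x)^*)]) /\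
    (* recursion relations *)
    (forall k z, (1 <= k <= n)%N -> slit z ->
       colv (ap k z) (bp k z) =
         Lmat t (qcoef pc) k z *m colv (ap k.-1 z) (bp k.-1 z) /\
       colv (am k z) (bm k z) =
         Lmat t (qcoef pc) k z *m colv (am k.-1 z) (bm k.-1 z)) /\
    (* the coefficients are almost periodic trigonometric polynomials in sqrt z *)
    (forall k, (k <= n)%N ->
       [/\ trig_poly_sqrt (ap k), trig_poly_sqrt (bp k),
           trig_poly_sqrt (am k) & trig_poly_sqrt (bm k)]).

Proof.
move=> n1 tn pc0; set q := qcoef pc.
have q0 k : (k <= n)%N -> q k != 0 by exact: qcoef_neq0.
have qn : 0 < q n by exact: qcoef_gt0 (leqnn n).
have q00 : 0 < q 0%N by exact: qcoef_gt0 (leq0n n).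
pose vp k z := coef_plus n t q (n - k) z; pose vm k z := coef_minus t q k z.
pose ap k z := (vp k z).1; pose bp k z := (vp k z).2.
pose am k z := (vm k z).1; pose bm k z := (vm k z).2.
have vpE z : (fun k => (ap k z, bp k z)) = vp^~ z.
  by apply/funext => k; rewrite -surjective_pairing.
have vmE z : (fun k => (am k z, bm k z)) = vm^~ z.
  by apply/funext => k; rewrite -surjective_pairing.
have mp z : matched n t pc (vp^~ z) z by move=> k kn; exact: coef_plus_rec.
have mm z : matched n t pc (vm^~ z) z by case.
have vpn z : vp n z = (1, 0) by rewrite /vp subnn.
have tp k : sqrt_trig_poly (ap k) /\ sqrt_trig_poly (bp k).
  exact: sqrt_trig_poly_coef_plus.
have tm k : sqrt_trig_poly (am k) /\ sqrt_trig_poly (bm k).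
  exact: sqrt_trig_poly_coef_minus.
have PpE z : Phi n t q ap bp z = wave n t pc (vp^~ z) z by rewrite PhiE // vpE.
have PmE z : Phi n t q am bm z = wave n t pc (vm^~ z) z by rewrite PhiE // vmE.
have upper z : 0 < complex.Im z ->
  [/\ fundamental_system (pfun n t pc) z (Phi n t q ap bp z) (Phi n t q am bm z),
      lies_right_L2 (Phi n t q ap bp z) & lies_left_L2 (Phi n t q am bm z)].
  move=> z0; have s0 := Im_psqrt_gt0 z0; rewrite PpE PmE; split.
  - split; [exact: wave_solution|exact: wave_solution|].
    by move=> al be; exact: (wave_independent n1 tn pc0 z0 (mm z)).
  (* The half-line in [lies_right_L2] is closed while the last interval excludes [t n], hence the
     shift by [1]. *)
  - apply: (@lies_right_L2_sqrt_exp _ (t n + 1) (q n) z) => // x tx.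
    rewrite wave_right //; last by apply: lt_le_trans tx; rewrite ltrDl.
    by rewrite vpn /wave_val /= mul1r mul0r addr0.
  - apply: (@lies_left_L2_sqrt_exp _ (t 1%N) (q 0%N) z) => // x tx.
    by rewrite wave_left // /wave_val /= mul0r mul1r add0r.
have wave_holo (a b : nat -> R[i] -> R[i]) x :
    (forall k, sqrt_trig_poly (a k) /\ sqrt_trig_poly (b k)) ->
    holo_on slit (fun z => Phi n t q a b z x).
  move=> tab; have [ta tb] := tab (interval_index t n x).
  apply: sqrt_trig_poly_holo.
  have := sqrt_trig_poly_wave_val (q (interval_index t n x)) x ta tb.
  by congr sqrt_trig_poly; apply/funext => z; rewrite PhiE.
exists ap, bp, am, bm.
split=> [z|]; first by rewrite /ap /bp vpn.
split=> [l _|]; first by have [] := tp l; split; exact: sqrt_trig_poly_holo.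
split=> [j _|]; first by have [] := tm j; split; exact: sqrt_trig_poly_holo.
split=> [z _|]; first by rewrite PpE PmE; split; exact: wave_solution.
split=> [x|]; first by split; exact: wave_holo.
split=> //.
split=> [z z0|].
  have [|[sp sm indep] [c rp] [d lm]] := upper z^*; first by rewrite Im_conj oppr_gt0.
  split; [split|by exists c; exact: L2_on_conj|by exists d; exact: L2_on_conj].
  - by have := is_solution_conj sp; rewrite conjCK.
  - by have := is_solution_conj sm; rewrite conjCK.
  (* Conjugating the relation gives one between [Phi^+] and [Phi^-] at the conjugate of [z], with
     conjugate coefficients. *)
  move=> al be H; have [|al0 be0] := indep al^* be^*.
    move=> x; have := congr1 Num.conj (H x).
    by rewrite rmorphD !rmorphM /= !conjCK rmorph0.
  by rewrite -[al]conjCK -[be]conjCK al0 be0 rmorph0.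
split=> [k z kn _|k _].
  by split; apply: Lmat_transfer; [exact: mp|exact: mm].
by have [? ?] := tp k; have [? ?] := tm k; split; exact: sqrt_trig_poly_slit.
Qed.
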